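(* Let $f\colon[0,1]\to[0,1]$ be a map satisfying the Manneville--Pomeau type conditions (1)--(5) listed in the context. Then there exists $\alpha\in\bigl(0,\frac12\bigr)$ such that for every $p\in[0,1]$ the exceptional set $$\mathcal E_f(p)=\bigl\{x\in[0,1]: p\notin\overline{\{f^n x:n\ge 0\}}\bigr\}$$ is $\alpha$-strong winning for Schmidt's game on $[0,1]$.
   Context: Conditions on $f$. The map $f\colon[0,1]\to[0,1]$ is a two-branched interval map for which there exists $r_1\in(0,1)$ such that (one-sided derivatives being used where needed): (1) $f((0,r_1))=f((r_1,1))=(0,1)$; (2) $f$ is $C^1$ on $[0,r_1)$ and $C^2$ on $(0,r_1)\cup(r_1,1]$; (3) $f(0)=f(r_1)=0$, $f(1)=1$, $f'(0)=1$, and $|f'|>1$ on $(0,1]$; (4) $\sup_{x\in[0,1]}|f'(x)|<\infty$ and $\sup_{x\in(r_1,1]}|f''(x)|<\infty$; (5) there exist $C\ge1$ and $\gamma>0$ such that $C^{-1}\le f''(x)/x^{\gamma-1}\le C$ for all $x\in(0,r_1)$. (The standard example is $f(x)=x+x^{1+\gamma}$ for $0\le x<r_1$ and $f(x)=x+x^{1+\gamma}-1$ for $r_1\le x\le1$, where $r_1+r_1^{1+\gamma}=1$.) Strong Schmidt game. Let $I\subset\mathbb R$ be a compact interval, $\alpha,\beta\in(0,1)$, and $S\subset I$. In the $(\alpha,\beta)$-strong game on $I$ with target set $S$, Bob first chooses any compact (nondegenerate) interval $B_1\subset I$; thereafter Alice and Bob alternately choose nested compact intervals $B_1\supset A_1\supset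 B_2\supset A_2\supset\cdots$ (Alice chooses the $A_k$, Bob chooses the $B_k$) with $|A_k|\ge\alpha|B_k|$ and $|B_{k+1}|\ge\beta|A_k|$ for all $k\ge1$, where $|\cdot|$ is length. Alice wins if $\bigcap_{k\ge1}B_k\cap S\ne\emptyset$. The set $S$ is $\alpha$-strong winning (on $I$) if for every $\beta\in(0,1)$ Alice has a winning strategy in the $(\alpha,\beta)$-strong game on $I$ with target set $S$. *)

(* Defs.v *)
From HB Require Import structures.
From mathcomp Require Import all_boot all_order all_algebra.
From mathcomp Require Import all_classical all_reals all_analysis.
Set Implicit Arguments.
Unset Strict Implicit.
Unset Printing Implicit Defensive.
Import Order.TTheory GRing.Theory Num.Theory numFieldNormedType.Exports.
Local Open Scope classical_set_scope.
Local Open Scope ring_scope.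

Section TwoBranchedMaps.
Context {R : realType}.
Implicit Types (r x y : R) (f g : R -> R) (D : set R).

(* The map on [0, 1] has a jump at r and is continuous from the right there, so
   r belongs to the second branch. *)
Definition branch r x : set R := if x < r then `[0, r[%classic else `[r, 1]%classic.

Definition slope f x y : R := (f y - f x) / (y - x).

(* Derivative of f at x along the branch containing x: the usual derivative if
   x lies in ]0, r[ or ]r, 1[, the right derivative at 0 and at r, the left
   derivative at 1. *)
Definition bderivable r f x : Prop :=
  cvg (slope f x @ within (branch r x) x^').

Definition bderive r f x : R :=
  lim (slope f x @ within (branch r x) x^').

Definition C1_on r D f : Prop :=
  (forall x, D x -> bderivable r f x) /\ {within D, continuous (bderive r f)}.

Definition C2_on r D f : Prop := C1_on r D f /\ C1_on r D (bderive r f).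

(* Only the values of f on [0, 1] matter. *)
Record manneville_pomeau_at f r : Prop := {
  mp_self_map : forall x, 0 <= x <= 1 -> 0 <= f x <= 1 ;
  mp_r_in : 0 < r < 1 ;
  mp_image1 : f @` `]0, r[ = `]0, 1[%classic ;
  mp_image2 : f @` `]r, 1[ = `]0, 1[%classic ;
  mp_C1 : C1_on r `[0, r[ f ;
  mp_C2 : C2_on r (`]0, r[ `|` `]r, 1]) f ;
  mp_f0 : f 0 = 0 ;
  mp_fr : f r = 0 ;
  mp_f1 : f 1 = 1 ;
  mp_df0 : bderive r f 0 = 1 ;
  mp_derivable_r : bderivable r f r ;
  mp_df_gt1 : forall x, 0 < x <= 1 -> 1 < `|bderive r f x| ;
  mp_df_bounded :
    exists M : R, forall x, 0 <= x <= 1 -> `|bderive r f x| <= M ;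
  mp_ddf_bounded :
    exists M : R, forall x, r < x <= 1 -> `|bderive r (bderive r f) x| <= M ;
  mp_ddf_near0 : exists C gamma : R, [/\ 1 <= C, 0 < gamma &
    forall x, 0 < x < r ->
      C^-1 <= bderive r (bderive r f) x / x `^ (gamma - 1) <= C]
}.

Definition manneville_pomeau f : Prop := exists r, manneville_pomeau_at f r.

Definition forward_orbit f x : set R := [set iter n f x | n in [set: nat]].

Definition exceptional_set f (p : R) : set R :=
  [set x | 0 <= x <= 1 /\ ~ closure (forward_orbit f x) p].

End TwoBranchedMaps.

Section StrongSchmidtGame.
Context {R : realType}.

(* Compact nondegenerate intervals. The first move of Bob is nondegenerate by
   the rules, and the length conditions force all later moves to be so. *)
Record cinterval := CInterval {
  lo : R ;
  hi : R ;
  lo_lt_hi : lo < hi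
}.

Definition cset (J : cinterval) : set R := `[lo J, hi J]%classic.
Definition len (J : cinterval) : R := hi J - lo J.

Definition unit_cinterval : cinterval := CInterval (@ltr01 R).

Implicit Types (alpha beta : R) (I : cinterval) (S : set R).

(* A strategy of Alice gives her k-th move from the moves B_1, ..., B_k of Bob;
   her own earlier moves are determined by these. The moves of Bob are indexed
   from 0. *)
Definition strategy := seq cinterval -> cinterval.

Definition alice (sigma : strategy) (B : nat -> cinterval) (k : nat) :
  cinterval := sigma (mkseq B k.+1).

Definition bob_legal beta I (sigma : strategy) (B : nat -> cinterval) (k : nat)
  : Prop :=
  if k is k'.+1 then
    cset (B k) `<=` cset (alice sigma B k') /\
    beta * len (alice sigma B k') <= len (B k)
  else cset (B 0%N) `<=` cset I.

Definition alice_legal alpha (sigma : strategy) (B : nat -> cinterval) (k : nat)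
  : Prop :=
  cset (alice sigma B k) `<=` cset (B k) /\
  alpha * len (B k) <= len (alice sigma B k).

(* Alice has to answer legally as long as Bob has played legally so far, and to
   win every infinite play in which Bob plays legally. *)
Definition winning_strategy alpha beta I S (sigma : strategy) : Prop :=
  forall B : nat -> cinterval,
    (forall n, (forall k, (k <= n)%N -> bob_legal beta I sigma B k) ->
       alice_legal alpha sigma B n) /\
    ((forall k, bob_legal beta I sigma B k) ->
       (\bigcap_k cset (B k)) `&` S !=set0).

Definition strong_winning alpha I S : Prop :=
  forall beta, 0 < beta < 1 ->
    exists sigma : strategy, winning_strategy alpha beta I S sigma.

End StrongSchmidtGame.

(* Main.v *)
Require Import Defs.
From mathcomp Require Import all_boot all_order all_algebra.
From mathcomp Require Import all_classical all_reals all_analysis.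
From mathcomp Require Import ring lra zify.
Set Implicit Arguments.
Unset Strict Implicit.
Unset Printing Implicit Defensive.
Import Order.TTheory GRing.Theory Num.Theory numFieldNormedType.Exports.
Local Open Scope classical_set_scope.
Local Open Scope ring_scope.

(** The constant 1/4 works for every map and every point. The proof has four
ingredients.

Reduction to bounded distortion. Let h0, h1 be the inverse branches of f and
g_k := h0^k o h1. The maps g_k are the inverse branches of the map induced by f
on passing through [r, 1], and a point x with f^n x in [r, 1] is the image of
f^(n+1) x under a composition g_w of such branches ([itinerary]). An orbit that
comes close to p > 0 is later close to some q at a time which directly follows
a visit to [r, 1]; when p is r or a preimage of r, one side of p is sent close
to 0 instead, and q is then 1 ([returns_near_exists]). For p = 0, an orbit in the
left branch moves away from 0, so it can enter a small neighbourhood of 0 only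
from [r, 1], unless it starts there. Hence it is enough that x avoids all the
sets g_w(B(0, eps)) and g_w(B(q, eps)) for some eps > 0
([avoids_exceptional]).

Bounded distortion. All the g_w distort lengths by a uniformly bounded factor
([word_map_distortion]). On the right branch f' is Lipschitz and at least
kap > 1. On the left branch the oscillation of f' on an interval is at most
that of phi(x) = c x^gamma. The variation of phi over a subinterval of the
fundamental interval h0^j [r, 1] is at most a constant times the proportion of
that subinterval times the variation of phi over the fundamental interval, and
the variations over all the fundamental intervals telescope; so the total oscillation met along h0^k is at most a constant times
the length of the interval one starts from in [r, 1]. These lengths decay
geometrically along a word.

Counting. The cylinders g_w[0, 1] are nested or have disjoint interiors, and
the length of g_(wv)[0, 1] is at most a constant times kap^(-|v|) times the
length of g_w[0, 1]. Thus an interval of length s meets only O(log(1/rho))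
cylinders with length between s and s/rho ([relevant_words_bound]).

The game. Alice plays in stages of T moves. During a stage she deals with the
threats g_w(B(t, eps)) whose cylinder has a length comparable to the interval E
of Bob that opens the stage; each threat is short compared with every interval
of the stage because eps is small. In each move she takes the leftmost or the
rightmost quarter of the interval of Bob, whichever meets fewer remaining
threats. No threat meets both, so the number of threats is halved, and fewer
than 2^T of them are gone after T moves ([staged_winning]). The number of
threats is O(T) by the counting, with constants that depend on the parameter of
Bob, on his first interval and on f, so a suitable T exists
([stage_plan_avoiding]). *)

(** * Derivatives along branches *)

Section BranchDerivatives.
Context {R : realType}.
Implicit Types (r x y a b : R) (f g : R -> R).

Lemma bderivable_slope r f x : bderivable r f x ->
  forall e, 0 < e -> exists2 d, 0 < d & forall y, branch r x y -> y != x ->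
    `|y - x| < d -> `|bderive r f x - slope f x y| < e.
Proof.
move=> df e e0.
have /cvgrPdist_lt/(_ e e0) : slope f x @ within (branch r x) x^' -->
    bderive r f x by exact: df.
rewrite near_withinE => -[d /= d0 dP].
exists d => // y by_ yx yd; apply: dP => //=.
by rewrite distrC.
Qed.

Lemma bderivable_continuous r f x : bderivable r f x ->
  forall e, 0 < e -> exists2 d, 0 < d & forall y, branch r x y ->
    `|y - x| < d -> `|f x - f y| < e.
Proof.
move=> /bderivable_slope df e e0.
have [d d0 dP] := df _ ltr01.
pose c := `|bderive r f x| + 1.
have c0 : 0 < c by rewrite /c; have := normr_ge0 (bderive r f x); lra.
exists (Num.min d (e / c)); first by rewrite lt_min d0 divr_gt0.
move=> y by_; rewrite lt_min => /andP[yd ye].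
have [->|yx] := eqVneq y x; first by rewrite subrr normr0.
have {}dP := dP y by_ yx yd.
have yx0 : y - x != 0 by rewrite subr_eq0.
have -> : f x - f y = - (slope f x y * (y - x)) by rewrite /slope; field.
rewrite normrN normrM.
have sc : `|slope f x y| <= c.
  rewrite /c; have := ler_normB (bderive r f x) (bderive r f x - slope f x y).
  by rewrite opprB addrC subrK; lra.
apply: le_lt_trans (_ : c * `|y - x| < e); first by rewrite ler_wpM2r.
by rewrite mulrC -ltr_pdivlMr.
Qed.

Lemma within_itv_continuous g a b :
    (forall x, a <= x <= b -> forall e, 0 < e -> exists2 d, 0 < d &
      forall y, a <= y <= b -> `|y - x| < d -> `|g x - g y| < e) ->
  {within `[a, b], continuous g}.
Proof.
move=> gc; apply/subspace_continuousP => x /=; rewrite in_itv/= => xab.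
apply/cvgrPdist_lt => e e0.
have [d d0 dP] := gc x xab e e0.
rewrite near_withinE; exists d => //= y xyd /=; rewrite in_itv => yab.
by apply: dP => //; rewrite distrC.
Qed.

Lemma bderivable_is_derive r f x : bderivable r f x ->
  (\forall y \near x, branch r x y) -> is_derive x 1 f (bderive r f x).
Proof.
move=> df [u /= u0 uP].
suff K : h^-1 *: ((f \o shift x) (h *: 1) - f x) @[h --> 0^'] --> bderive r f x.
  by apply: DeriveDef; [exact: cvgP K | exact: cvg_lim K].
apply/cvgrPdist_lt => e e0.
have [d d0 dP] := bderivable_slope df e0.
exists (Num.min d u); first by rewrite /= lt_min d0.
move=> h /=; rewrite sub0r normrN lt_min => /andP[hd hu] h0.
have -> : h^-1 *: (f (h *: 1 + x) - f x) = slope f x (h + x).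
  by rewrite /slope addrK mulrC /GRing.scale/= mulr1.
apply: dP.
- by apply: uP; rewrite /= opprD addrCA subrr addr0 normrN.
- by rewrite -subr_eq0 addrK.
- by rewrite addrK.
Qed.

Lemma branch_sub_left r x y : x < r -> 0 <= y < r -> branch r x y.
Proof. by move=> xr yr; rewrite /branch xr /= in_itv. Qed.

Lemma branch_sub_right r x y : r <= x -> r <= y <= 1 -> branch r x y.
Proof. by move=> xr yr; rewrite /branch ltNge xr /= in_itv. Qed.

Lemma near_itv_oo a b x : a < x < b -> \forall y \near x, a < y < b.
Proof.
move=> xab; have := @near_in_itvoo R a b x.
by rewrite in_itv => /(_ xab); apply: filterS => y; rewrite in_itv.
Qed.

Lemma near_branch r x : 0 < x -> x < 1 -> x != r -> \forall y \near x, branch r x y.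
Proof.
move=> x0 x1; rewrite neq_lt => /orP[xr|xr].
  have := @near_itv_oo 0 r x; rewrite x0 xr => /(_ isT); apply: filterS => y.
  by move=> /andP[y0 yr]; apply: branch_sub_left; rewrite // ltW.
have := @near_itv_oo r 1 x; rewrite x1 xr => /(_ isT); apply: filterS => y.
by move=> /andP[y0 yr]; apply: branch_sub_right; rewrite // ltW// ltW.
Qed.

(** The function [g] is allowed to differ from [f] at the end points so that the
left branch can be used with its continuous extension to its right end. *)
Lemma branch_MVT r f g a b : 0 <= a -> a < b -> b <= 1 -> b <= r \/ r <= a ->
    {within `[a, b], continuous g} ->
    (forall x, a < x < b -> bderivable r f x) ->
    (forall x, a < x < b -> g x = f x) ->
  exists2 x, a < x < b & g b - g a = bderive r f x * (b - a).
Proof.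
move=> a0 ab b1 arb gc df gf.
have [x|x] := @MVT R g (bderive r f) a b ab _ gc; rewrite in_itv/=; last by exists x.
move=> xab; have /andP[ax xb] := xab.
apply: (@near_eq_is_derive _ _ _ f g).
  by have := near_itv_oo xab; apply: filterS => y /gf.
apply: bderivable_is_derive; first exact: df.
apply: near_branch; [lra|lra|].
by apply/eqP => xr; case: arb; lra.
Qed.

Lemma branch_MVT_self r f a b : 0 <= a -> a < b -> b <= 1 -> b < r \/ r <= a ->
    (forall x, a <= x <= b -> bderivable r f x) ->
  exists2 x, a < x < b & f b - f a = bderive r f x * (b - a).
Proof.
move=> a0 ab b1 arb df; apply: branch_MVT => //.
- by case: arb => [/ltW|]; [left|right].
- apply: within_itv_continuous => x xab e e0.
  have [d d0 dP] := bderivable_continuous (df x xab) e0.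
  exists d => // y yab; apply: dP.
  by case: arb => arb; [apply: branch_sub_left|apply: branch_sub_right]; lra.
- by move=> x xab; apply: df; lra.
Qed.

End BranchDerivatives.

(** * Slopes of the two branches *)

Section MannevillePomeauBranches.
Context {R : realType}.
Implicit Types (r x y a b : R) (f g : R -> R).

(** Every slope of [g] is a value of [d] at an interior point, so an oscillation
bound for [d] in terms of [psi] is a bound for the differences of slopes. *)
Definition slope_control (kap M : R) (psi : R -> R) (lo hi : R) (g : R -> R) :=
  exists d : R -> R,
  [/\ forall x y, lo <= x -> x < y -> y <= hi ->
        exists2 z, x < z < y & g y - g x = d z * (y - x),
      forall z, lo < z < hi -> kap <= d z <= M &
      forall z z', lo < z -> z <= z' -> z' < hi ->
        `|d z' - d z| <= psi z' - psi z].

(** The continuous extension to [0, r] of the left branch; [f] itself jumps to 0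
at [r]. *)
Definition left_branch r f x := if x < r then f x else 1.

Variables (f : R -> R) (r : R).
Hypothesis hf : manneville_pomeau_at f r.
Local Notation d := (bderive r f).
Local Notation dd := (bderive r (bderive r f)).

Lemma mp_r01 : 0 < r < 1. Proof. exact: (mp_r_in hf). Qed.

Lemma mp_bderivable x : 0 <= x <= 1 -> bderivable r f x.
Proof.
move=> x01; have := mp_r01 => r01.
have [xr|xr|->] := ltgtP x r; last exact: (mp_derivable_r hf).
  by apply: (mp_C1 hf).1; rewrite /= in_itv/=; lra.
by apply: (mp_C2 hf).1.1; right; rewrite /= in_itv/=; lra.
Qed.

Lemma mp_derivative_bderivable x : 0 < x <= 1 -> x != r -> bderivable r d x.
Proof.
move=> x01; rewrite neq_lt => /orP[xr|xr]; apply: (mp_C2 hf).2.1.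
  by left; rewrite /= in_itv/=; lra.
by right; rewrite /= in_itv/=; lra.
Qed.

Lemma mp_second_derivative_left : exists C gamma : R, [/\ 0 < C, 0 < gamma &
  forall x, 0 < x < r -> 0 < dd x <= C * x `^ (gamma - 1)].
Proof.
have [C [g [C1 g0 H]]] := mp_ddf_near0 hf.
have C0 : 0 < C by lra.
exists C, g; split => // x xr; have /andP[] := H x xr.
have p0 : 0 < x `^ (g - 1) by rewrite powR_gt0; lra.
rewrite ler_pdivrMr// => + ->; rewrite ler_pdivlMr// andbT => {H}H.
by apply: lt_le_trans H; rewrite mulr_gt0 ?invr_gt0.
Qed.

Lemma mp_derivative_ndecr_left x y : 0 < x -> x <= y -> y < r -> d x <= d y.
Proof.
move=> x0; rewrite le_eqVlt => /orP[/eqP->//|xy] yr.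
have := mp_r01 => r01; have [C [g [C0 g0 ddP]]] := mp_second_derivative_left.
have [|||||z zxy E] := @branch_MVT_self _ r d x y; try lra.
- by move=> z zxy; apply: mp_derivative_bderivable; [lra|apply/eqP; lra].
- have /andP[d0 _] : 0 < dd z <= C * z `^ (g - 1) by apply: ddP; lra.
  by rewrite -subr_ge0 E mulr_ge0//; lra.
Qed.

(** The derivative is 1 at 0, continuous there and nondecreasing, so it is
positive; then the bound on its absolute value makes it larger than 1. *)
Lemma mp_derivative_gt1_left x : 0 < x < r -> 1 < d x.
Proof.
move=> x0r; have := mp_r01 => r01.
suff d1 : 1 <= d x.
  by have := mp_df_gt1 hf (x := x); rewrite ger0_norm; [apply; lra|lra].
apply/ler_addgt0Pr => e e0.
have [_ /subspace_continuousP] := mp_C1 hf.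
move=> /(_ 0); rewrite /= in_itv/= lexx (andP r01).1 => /(_ isT).
move=> /cvgrPdist_lt/(_ e e0); rewrite near_withinE => -[u /= u0 uP].
pose y := Num.min (u / 2) x.
have y0 : 0 < y by rewrite lt_min; apply/andP; split; lra.
have yx : y <= x by rewrite ge_min lexx orbT.
have yu : y <= u / 2 by rewrite ge_min lexx.
have := mp_derivative_ndecr_left y0 yx (andP x0r).2.
have := uP y; rewrite /= sub0r normrN gtr0_norm// in_itv/=.
have -> : y < u by lra.
have -> : (0 <= y < r) = true by lra.
by move=> /(_ isT isT); rewrite /from_subspace (mp_df0 hf) ltr_norml; lra.
Qed.

Lemma mp_left_expanding x y : 0 <= x -> x < y -> y < r -> y - x < f y - f x.
Proof.
move=> x0 xy yr; have := mp_r01 => r01.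
have [|||||z zxy ->] := @branch_MVT_self _ r f x y; try lra.
- by move=> z zxy; apply: mp_bderivable; lra.
- have d1 : 1 < d z by apply: mp_derivative_gt1_left; lra.
  by rewrite ltr_pMl// subr_gt0.
Qed.

Lemma mp_left_surj y : 0 <= y < 1 -> exists2 x, 0 <= x < r & f x = y.
Proof.
have := mp_r01 => r01; move=> /andP[]; rewrite le_eqVlt => /orP[/eqP<- _|y0 y1].
  by exists 0; [lra|exact: (mp_f0 hf)].
have : `]0, 1[%classic y by rewrite /= in_itv/= y0.
rewrite -(mp_image1 hf) => -[x /=]; rewrite in_itv/= => xr <-.
by exists x => //; lra.
Qed.

Lemma mp_left_lt1 x : 0 <= x < r -> 0 <= f x < 1.
Proof.
move=> /andP[]; rewrite le_eqVlt => /orP[/eqP<-|x0 xr]; first by rewrite (mp_f0 hf); lra.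
have : (f @` `]0, r[) (f x) by exists x => //; rewrite /= in_itv/= x0.
by rewrite (mp_image1 hf) /= in_itv/=; lra.
Qed.

Lemma mp_right_surj y : 0 <= y <= 1 -> exists2 x, r <= x <= 1 & f x = y.
Proof.
have := mp_r01 => r01; move=> /andP[].
rewrite le_eqVlt => /orP[/eqP<- _|y0].
  by exists r; [lra|exact: (mp_fr hf)].
rewrite le_eqVlt => /orP[/eqP->|y1].
  by exists 1; [lra|exact: (mp_f1 hf)].
have : `]0, 1[%classic y by rewrite /= in_itv/= y0.
rewrite -(mp_image2 hf) => -[x /=]; rewrite in_itv/= => xr <-.
by exists x => //; lra.
Qed.

Lemma mp_left_near1 e : 0 < e ->
  exists2 u, 0 < u & forall y, 0 <= y < r -> r - u < y -> 1 - f y < e.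
Proof.
move=> e0; have := mp_r01 => r01; pose e' := Num.min e (1 / 2).
have e'0 : 0 < e' by rewrite lt_min e0; lra.
have e'h : e' <= 1 / 2 by rewrite ge_min lexx orbT.
have e'e : e' <= e by rewrite ge_min lexx.
have [|z zr fz] := @mp_left_surj (1 - e'); first lra.
exists (r - z); first lra.
by move=> y y0r yz; have := @mp_left_expanding z y; lra.
Qed.

Lemma left_branch_continuous : {within `[0, r], continuous left_branch r f}.
Proof.
have := mp_r01 => r01.
apply: within_itv_continuous => x; rewrite le_eqVlt.
rewrite [x <= r]le_eqVlt => xr e e0.
have [xr'|rx] := ltP x r.
  have [|u u0 uP] := @bderivable_continuous _ r f x _ e e0.
    apply: mp_bderivable; lra.
  exists (Num.min u (r - x)); first by rewrite lt_min u0; lra.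
  move=> y y0r; rewrite lt_min => /andP[yu]; rewrite ltr_norml => yrx.
  rewrite /left_branch xr'; have -> : y < r by lra.
  by apply: uP => //; apply: branch_sub_left; lra.
have -> : x = r by case: eqP xr rx => //; lra.
have [z z0 zP] := mp_left_near1 e0.
exists z => // y y0r; rewrite ltr_norml => yzr; rewrite /left_branch ltxx.
case: ifPn => yr; last by rewrite subrr normr0.
have := @mp_left_lt1 y; have := zP y.
by rewrite ltr_norml; lra.
Qed.

(** The second derivative is at most a multiple of x^(gamma-1), the derivative of
a multiple of x^gamma; so the increments of f' are at most those of a multiple
of x^gamma. *)
Lemma mp_left_slopes : exists M c gamma : R, [/\ 1 <= M, 0 < c, 0 < gamma &
  slope_control 1 M (fun x => c * x `^ gamma) 0 r (left_branch r f)].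
Proof.
have := mp_r01 => r01.
have [M MP] := mp_df_bounded hf.
have [C [g [C0 g0 ddP]]] := mp_second_derivative_left.
exists (Num.max M 1), (C / g), g; split => //.
- by rewrite le_max lexx orbT.
- by rewrite divr_gt0.
exists d; split.
- move=> x y x0 xy yr.
  apply: branch_MVT => //; first lra.
  + by left.
  + apply: continuous_subspaceW left_branch_continuous => z /=.
    by rewrite !in_itv/=; lra.
  + by move=> z zxy; apply: mp_bderivable; lra.
  + by move=> z zxy; rewrite /left_branch ifT//; lra.
- move=> z zr; rewrite (ltW (mp_derivative_gt1_left zr)) le_max.
  apply/andP; split=> //; apply/orP; left.
  apply: le_trans (MP z _); last lra.
  exact: ler_norm.
- move=> z z' z0; rewrite le_eqVlt => /orP[/eqP->|zz' z'r].
    by rewrite !subrr normr0.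
  rewrite ger0_norm ?subr_ge0; last by apply: mp_derivative_ndecr_left => //; apply: ltW.
  (* The derivative of h is nonnegative. *)
  pose h x := C / g * x `^ g - d x.
  pose h' x := C * x `^ (g - 1) - dd x.
  have hd x : 0 < x < r -> is_derive x 1 h (h' x).
    move=> xr; have x0 : 0 < x by lra.
    have D1 : is_derive x 1 d (dd x).
      apply: bderivable_is_derive; first by apply: mp_derivative_bderivable; [lra|apply/eqP; lra].
      by apply: near_branch => //; [lra|apply/eqP; lra].
    rewrite /h' /h.
    have D2 := is_derive1_powR g x0.
    apply: is_derive_eq; rewrite /GRing.scale/= mulrA mulfVK//.
    by apply/eqP; lra.
  have [x||x] := @MVT R h h' z z' zz'.
  + by rewrite in_itv/= => ?; apply: hd; lra.
  + apply: derivable_within_continuous => x; rewrite in_itv/= => xz.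
    by have [] := hd x; [lra|].
  + rewrite in_itv/= => xz E.
    have : 0 <= h z' - h z.
      rewrite E mulr_ge0//; last lra.
      by have := ddP x; rewrite /h'; lra.
    by rewrite /h; lra.
Qed.

Lemma mp_second_derivative_right : exists2 L, 0 < L & forall x, r < x <= 1 -> `|dd x| <= L.
Proof.
have [M MP] := mp_ddf_bounded hf; exists (Num.max M 1).
  by rewrite lt_max ltr01 orbT.
by move=> x xr; rewrite le_max MP.
Qed.

(** At [r] only the right derivative is available; it is a limit of slopes, hence
of values of the derivative at points to the right of [r]. *)
Lemma mp_derivative_lipschitz_right : exists2 L, 0 < L &
  forall x y, r <= x -> x <= y -> y <= 1 -> `|d y - d x| <= L * (y - x).
Proof.
have := mp_r01 => r01; have [L L0 LP] := mp_second_derivative_right; exists L => //.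
have lip x y : r < x -> x <= y -> y <= 1 -> `|d y - d x| <= L * (y - x).
  move=> rx; rewrite le_eqVlt => /orP[/eqP->|xy] y1.
    by rewrite !subrr normr0 mulr0.
  have [|||||z zxy ->] := @branch_MVT_self _ r d x y; try lra.
    by move=> z zxy; apply: mp_derivative_bderivable; [lra|apply/eqP; lra].
  rewrite normrM (gtr0_norm (x := y - x)); last lra.
  by rewrite ler_wpM2r ?LP //; lra.
move=> x y; rewrite le_eqVlt => /orP[/eqP<-|]; last exact: lip.
move=> ry y1; apply/ler_addgt0Pr => e e0.
move: ry; rewrite le_eqVlt => /orP[/eqP->|ry].
  by rewrite !subrr normr0 mulr0; lra.
have [u u0 uP] := bderivable_slope (mp_derivable_r hf) e0.
pose w := Num.min (r + u / 2) y.
have rw_ : r < w by rewrite lt_min ry andbT; lra.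
have wy : w <= y by rewrite ge_min lexx orbT.
have wu : w <= r + u / 2 by rewrite ge_min lexx.
have [|||||z zrw E] := @branch_MVT_self _ r f r w; try lra.
  by move=> z zrw; apply: mp_bderivable; lra.
have := uP w; rewrite /slope E mulfK; last by apply/eqP; lra.
have -> : `|w - r| < u by rewrite ltr_norml; lra.
have -> : (w != r) by apply/eqP; lra.
have bw : branch r r w by apply: branch_sub_right; lra.
move=> /(_ bw isT isT) H.
have := lip z y; have zy : L * (y - z) <= L * (y - r) by rewrite ler_pM2l//; lra.
rewrite ler_norml; have := ler_norm (d y - d z).
move: H; rewrite ltr_norml; rewrite ler_norml; lra.
Qed.

(** The derivative is continuous on [r, 1], so by the intermediate value theorem
it cannot change sign without vanishing, and its minimum is attained. *)
Lemma mp_derivative_gt1_right : exists2 kap, 1 < kap &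
  forall x, r <= x <= 1 -> kap <= d x.
Proof.
have := mp_r01 => r01; have [L L0 lip] := mp_derivative_lipschitz_right.
have dc a b : r <= a -> b <= 1 -> {within `[a, b], continuous d}.
  move=> ra b1; apply: within_itv_continuous => x xab e e0.
  exists (e / L); first by rewrite divr_gt0.
  move=> y yab; rewrite ltr_pdivlMr// mulrC.
  have [xy|yx] := leP x y.
    rewrite (ger0_norm (x := y - x)) ?subr_ge0// (distrC (d x)) => H.
    by apply: le_lt_trans H; apply: lip; lra.
  rewrite (ltr0_norm (x := y - x)) ?subr_lt0// opprB => H.
  by apply: le_lt_trans H; apply: lip; lra.
have [|||||z zr E] := @branch_MVT_self _ r f r 1; try lra.
  by move=> z zrw; apply: mp_bderivable; lra.
rewrite (mp_f1 hf) (mp_fr hf) subr0 in E.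
have dz : 0 < d z.
  by rewrite -(pmulr_lgt0 (x := 1 - r)) -?E //; lra.
have dpos x : r <= x <= 1 -> 0 < d x.
  move=> xr; rewrite ltNge; apply/negP => dx.
  have zero a b : r <= a -> a <= b -> b <= 1 ->
      Num.min (d a) (d b) <= 0 <= Num.max (d a) (d b) -> False.
    move=> ra ab b1 H; have [w] := IVT ab (dc _ _ ra b1) H.
    rewrite in_itv/= => wab dw; have := mp_df_gt1 hf (x := w).
    by rewrite dw normr0; lra.
  have [xz|zx] := leP x z.
    by apply: (zero x z); rewrite ?ge_min ?le_max ?dx ?(ltW dz) ?orbT //; lra.
  by apply: (zero z x); rewrite ?ge_min ?le_max ?dx ?(ltW dz) ?orbT //; lra.
have r1 : r <= 1 by lra.
have [c] := EVT_min r1 (dc r 1 (lexx _) (lexx _)).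
rewrite in_itv/= => cr cP; exists (d c).
  by have := mp_df_gt1 hf (x := c); rewrite gtr0_norm ?dpos//; apply; lra.
by move=> x xr; apply: cP; rewrite in_itv.
Qed.

Lemma mp_right_slopes : exists M kap L : R, [/\ 0 < L, 1 < kap &
  slope_control kap M (fun x => L * x) r 1 f].
Proof.
have := mp_r01 => r01.
have [M MP] := mp_df_bounded hf.
have [L L0 lip] := mp_derivative_lipschitz_right.
have [kap kap1 kapP] := mp_derivative_gt1_right.
exists M, kap, L; split => //.
exists d; split.
- move=> x y rx xy y1; apply: (@branch_MVT_self _ r f); try lra.
  by move=> z zxy; apply: mp_bderivable; lra.
- move=> z zr; rewrite kapP; last lra.
  by apply: le_trans (ler_norm _) (MP z _); lra.
- by move=> z z' rz zz' z'1; rewrite -mulrBr; apply: lip; lra.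
Qed.

End MannevillePomeauBranches.

(** * Distortion and inverse branches *)

Section Distortion.
Context {R : realType}.
Implicit Types (a b x y A B K : R) (g h psi : R -> R).

(** Ratios of lengths of subintervals of [A, B] change by a factor at most [K]
under [h]. The denominators are cleared, so degenerate subintervals are
allowed. *)
Definition distortion K h A B := forall a b a' b',
  A <= a -> a <= b -> b <= B -> A <= a' -> a' <= b' -> b' <= B ->
  (b - a) * (h b' - h a') <= K * ((b' - a') * (h b - h a)).

Lemma distortion_le K K' h A B : K <= K' ->
    (forall a b, A <= a -> a <= b -> b <= B -> h a <= h b) ->
  distortion K h A B -> distortion K' h A B.
Proof.
move=> KK' hm H a b a' b' Aa ab bB Aa' ab' bB'.
apply: le_trans (H _ _ _ _ Aa ab bB Aa' ab' bB') _.
by rewrite ler_wpM2r// mulr_ge0 ?subr_ge0 ?hm.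
Qed.

(** Distortion constants multiply, provided that the second map is measured only
on the image of the first. *)
Lemma distortion_comp K1 K2 g h A B : 0 <= K1 -> 0 <= K2 ->
    (forall a b, A <= a -> a < b -> b <= B -> g a < g b) ->
    (forall a b, g A <= a -> a <= b -> b <= g B -> h a <= h b) ->
    distortion K1 g A B -> distortion K2 h (g A) (g B) ->
  distortion (K1 * K2) (h \o g) A B.
Proof.
move=> K10 K20 gm hm D1 D2 a b a' b' Aa ab bB Aa' ab' bB' /=.
have gm' x y : A <= x -> x <= y -> y <= B -> g x <= g y.
  by move=> Ax; rewrite le_eqVlt => /orP[/eqP->//|xy] yB; apply/ltW/gm.
have AB : A <= B by lra.
move: ab; rewrite le_eqVlt => /orP[/eqP->|ab].
  by rewrite !subrr mul0r !mulr0.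
have gab := gm a b Aa ab bB.
have {}D1 := D1 a b a' b' Aa (ltW ab) bB Aa' ab' bB'.
have {}D2 : (g b - g a) * (h (g b') - h (g a')) <=
    K2 * ((g b' - g a') * (h (g b) - h (g a))).
  by apply: D2; apply: gm' => //; lra.
rewrite -(ler_pM2l (x := g b - g a)) ?subr_gt0//.
have Y0 : 0 <= h (g b) - h (g a) by rewrite subr_ge0; apply: hm; rewrite ?gm'//; lra.
rewrite mulrCA; apply: le_trans (ler_wpM2l _ D2) _; first lra.
have := ler_wpM2r (mulr_ge0 K20 Y0) D1.
set G := g b - g a; set G' := g b' - g a'; set Y := h (g b) - h (g a); lra.
Qed.

(** The increments of [psi] bound the oscillation of the derivative of the forward
branch, which is why they are taken over the image of [A, B]. *)
Record inverse_branch (kap M : R) psi (lo hi : R) h : Prop := {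
  ib_left : h 0 = lo ;
  ib_right : h 1 = hi ;
  ib_slope : forall a b, 0 <= a -> a <= b -> b <= 1 ->
    kap * (h b - h a) <= b - a <= M * (h b - h a) ;
  ib_distortion : forall A B, 0 <= A -> A <= B -> B <= 1 ->
    distortion (1 + (psi (h B) - psi (h A))) h A B }.

(** Two slopes s, s' >= 1 of [g] that differ by at most e satisfy
s <= s' + e <= (1 + e) s'; this is the distortion bound for the inverse. *)
Lemma inverse_branch_exists kap M psi lo hi g : lo < hi -> 1 <= kap ->
    slope_control kap M psi lo hi g ->
    (forall x y, lo <= x -> x <= y -> y <= hi -> psi x <= psi y) ->
    g lo = 0 -> g hi = 1 ->
    (forall y, 0 <= y <= 1 -> exists2 x, lo <= x <= hi & g x = y) ->
  exists2 h, inverse_branch kap M psi lo hi h &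
    forall x, lo <= x <= hi -> 0 <= g x <= 1 /\ h (g x) = x.
Proof.
move=> lohi kap1 [d [mvt db dpsi]] psim glo ghi surj.
have [h hP] : {h : R -> R & forall y, 0 <= y <= 1 -> lo <= h y <= hi /\ g (h y) = y}.
  apply: (@choice _ _ (fun y x => 0 <= y <= 1 -> lo <= x <= hi /\ g x = y)) => y.
  have [/surj[x xl gx]|ny] := pselect (0 <= y <= 1); first by exists x.
  by exists 0 => /ny.
have gm x y : lo <= x -> x < y -> y <= hi -> y - x <= g y - g x.
  move=> lx xy yh; have [z zxy ->] := mvt x y lx xy yh.
  have : 1 <= d z by have := db z; lra.
  by move=> dz; rewrite ler_peMl//; lra.
have hm a b : 0 <= a -> a < b -> b <= 1 -> h a < h b.
  move=> a0 ab b1; have [|hal gha] := hP a; try lra.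
  have [|hbl ghb] := hP b; try lra.
  rewrite ltNge le_eqVlt; apply/negP => /orP[/eqP E|ba].
    by move: ghb; rewrite E gha => E'; lra.
  by have := gm (h b) (h a); lra.
have inj x y : lo <= x <= hi -> lo <= y <= hi -> g x = g y -> x = y.
  move=> xl yl E; have [xy|xy|//] := ltgtP x y.
    by have := gm x y; lra.
  by have := gm y x; lra.
have grange x : lo <= x <= hi -> 0 <= g x <= 1.
  move=> /andP[lx xh]; rewrite -glo -ghi; apply/andP; split.
    move: lx; rewrite le_eqVlt => /orP[/eqP->//|lx].
    by have := gm lo x (lexx _) lx xh; lra.
  move: xh; rewrite le_eqVlt => /orP[/eqP->//|xh].
  by have := gm x hi lx xh (lexx _); lra.
exists h; last first.
  move=> x xl; have gx := grange x xl; split=> //.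
  by have [hgx ghg] := hP _ gx; apply: inj.
have hm' a b : 0 <= a -> a <= b -> b <= 1 -> h a <= h b.
  by move=> a0; rewrite le_eqVlt => /orP[/eqP->//|ab] b1; apply/ltW/hm.
have sl a b : 0 <= a -> a < b -> b <= 1 ->
    exists2 z, h a < z < h b & b - a = d z * (h b - h a).
  move=> a0 ab b1; have [|hal gha] := hP a; try lra.
  have [|hbl ghb] := hP b; try lra.
  have [||z zab E] := mvt (h a) (h b) _ (hm _ _ a0 ab b1); try lra.
  by exists z; rewrite // -E ghb gha.
split.
- have [|hal gha] := hP 0; try lra.
  by apply: inj => //; rewrite ?gha//; lra.
- have [|hal gha] := hP 1; try lra.
  by apply: inj => //; rewrite ?gha//; lra.
- move=> a b a0; rewrite le_eqVlt => /orP[/eqP->|ab] b1.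
    by rewrite !subrr !mulr0 lexx.
  have [z zab ->] := sl a b a0 ab b1.
  have := hm a b a0 ab b1; have [|hal _] := hP a; try lra.
  have [|hbl _] := hP b; try lra.
  move=> hab; have dz : kap <= d z <= M by apply: db; lra.
  by rewrite !ler_pM2r//; lra.
- move=> A B A0 AB B1 a b a' b' Aa ab bB Aa' ab' bB'.
  have [[hAl _] [hBl _]] : (lo <= h A <= hi /\ g (h A) = A) /\
    (lo <= h B <= hi /\ g (h B) = B) by split; apply: hP; lra.
  have [hAa hbB] : h A <= h a /\ h b <= h B by split; apply: hm'; lra.
  have [hAa' hbB'] : h A <= h a' /\ h b' <= h B by split; apply: hm'; lra.
  move: ab; rewrite le_eqVlt => /orP[/eqP->|ab].
    by rewrite !subrr mul0r !mulr0.
  move: ab'; rewrite le_eqVlt => /orP[/eqP->|ab'].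
    by rewrite !subrr mul0r !mulr0.
  have [|||z zab Ez] := sl a b; try lra.
  have [|||z' zab' Ez'] := sl a' b'; try lra.
  rewrite Ez Ez'; set p := h b - h a; set q := h b' - h a'.
  have p0 : 0 <= p by rewrite /p; lra.
  have q0 : 0 <= q by rewrite /q; lra.
  have -> : d z * p * q = d z * (p * q) by ring.
  have -> k : k * (d z' * q * p) = k * d z' * (p * q) by ring.
  apply: ler_wpM2r; first exact: mulr_ge0.
  have dz : kap <= d z <= M by apply: db; lra.
  have dz' : kap <= d z' <= M by apply: db; lra.
  have H : d z - d z' <= psi (h B) - psi (h A).
    have [zz|zz] := leP z z'.
      have /= := dpsi z z'; rewrite ler_norml.
      have := psim z z'; have := psim (h A) z; have := psim z' (h B); lra.
    have /= := dpsi z' z; rewrite ler_norml.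
    have := psim z' z; have := psim (h A) z'; have := psim z (h B); lra.
  set e := psi (h B) - psi (h A) in H *.
  have e0 : 0 <= e by rewrite subr_ge0; apply: psim; lra.
  have : e <= e * d z' by rewrite ler_peMr//; lra.
  lra.
Qed.

(** The hypotheses are symmetric in [s] and [t], so a negative exponent amounts to a
positive one with [s] and [t] exchanged. *)
Lemma powR_comparable (M e s t : R) : 1 <= M -> 0 < s -> 0 < t ->
  s <= M * t -> t <= M * s -> s `^ e <= M `^ `|e| * t `^ e.
Proof.
move=> M1 s0 t0 sMt tMs; have M0 : 0 <= M by lra.
have [e0|e0] := leP 0 e.
  rewrite ger0_norm// -powRM//; last lra.
  by apply: ge0_ler_powR => //; rewrite nnegrE ?mulr_ge0//; lra.
rewrite ltr0_norm// -[in s `^ e](opprK e) -[in t `^ e](opprK e) (powRN s) (powRN t).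
have tp : 0 < t `^ (- e) by rewrite powR_gt0.
have sp : 0 < s `^ (- e) by rewrite powR_gt0.
rewrite ler_pdivlMr// mulrC ler_pdivrMr// -powRM//; last lra.
by apply: ge0_ler_powR => //; rewrite ?nnegrE ?mulr_ge0//; lra.
Qed.

Lemma power_MVT (c gamma x y : R) : 0 < x -> x < y ->
  exists2 z, x < z < y &
    c * y `^ gamma - c * x `^ gamma = c * gamma * z `^ (gamma - 1) * (y - x).
Proof.
move=> x0 xy.
have D (z : R) : 0 < z ->
    is_derive z 1 (fun x : R => c * x `^ gamma) (c * gamma * z `^ (gamma - 1)).
  move=> z0; have D2 := is_derive1_powR gamma z0.
  by apply: is_derive_eq; rewrite /GRing.scale/= mulrA.
have [z||z] := @MVT R (fun x : R => c * x `^ gamma) (fun z : R => c * gamma * z `^ (gamma - 1)) x y xy.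
- by rewrite in_itv/= => zxy; apply: D; lra.
- apply: derivable_within_continuous => z; rewrite in_itv/= => xz.
  by have [] := D z; [lra|].
- by rewrite in_itv/= => zxy ->; exists z.
Qed.

(** By the mean value theorem the slopes of c x^gamma are multiples of
z^(gamma-1), and all points of [u, M u] are comparable to each other. *)
Lemma power_profile_comparable (M c gamma : R) : 1 <= M -> 0 < c -> 0 < gamma ->
  exists2 Q, 0 <= Q & forall u v x y, 0 < u -> u <= x -> x <= y -> y <= v ->
    v <= M * u ->
    (c * y `^ gamma - c * x `^ gamma) * (v - u) <=
      Q * ((y - x) * (c * v `^ gamma - c * u `^ gamma)).
Proof.
move=> M1 c0 g0.
exists (M `^ `|gamma - 1|); first exact: powR_ge0.
move=> u v x y u0 ux xy yv vMu.
move: xy; rewrite le_eqVlt => /orP[/eqP->|xy].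
  by rewrite !subrr !mul0r mulr0.
have [||z zxy ->] := @power_MVT c gamma x y; try lra.
have [||w wuv ->] := @power_MVT c gamma u v; try lra.
have Mm p q : p <= q -> M * p <= M * q by move=> pq; rewrite ler_wpM2l//; lra.
have p1 p : 0 < p -> p <= M * p by move=> pq; rewrite ler_peMl//; lra.
have H := @powR_comparable M (gamma - 1) z w M1.
have {}H : z `^ (gamma - 1) <= M `^ `|gamma - 1| * w `^ (gamma - 1).
  by have Muz := Mm u z; have Muw := Mm u w; apply: H; lra.
have k0 : 0 <= c * gamma * ((y - x) * (v - u)).
  by rewrite !mulr_ge0//; lra.
have := ler_wpM2l k0 H; lra.
Qed.

End Distortion.

Section InverseBranchTheory.
Context {R : realType} (kap M : R) (psi : R -> R) (lo hi : R) (h : R -> R).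
Hypotheses (lohi : lo < hi) (Hh : inverse_branch kap M psi lo hi h).

Lemma ib_lt a b : 0 <= a -> a < b -> b <= 1 -> h a < h b.
Proof.
move=> a0 ab b1; rewrite ltNge; apply/negP => ba.
have /andP[_] := ib_slope Hh (lexx 0) ler01 (lexx 1).
rewrite (ib_left Hh) (ib_right Hh) => M1.
have M0 : 0 < M.
  by rewrite -(pmulr_lgt0 (x := hi - lo)) ?subr_gt0//; apply: lt_le_trans M1; lra.
have /andP[_] := ib_slope Hh a0 (ltW ab) b1.
have : M * (h b - h a) <= 0 by rewrite mulr_ge0_le0//; lra.
lra.
Qed.

Lemma ib_le a b : 0 <= a -> a <= b -> b <= 1 -> h a <= h b.
Proof. by move=> a0; rewrite le_eqVlt => /orP[/eqP->//|ab] b1; apply/ltW/ib_lt. Qed.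

Lemma ib_range a : 0 <= a <= 1 -> lo <= h a <= hi.
Proof.
by move=> /andP[a0 a1]; rewrite -(ib_left Hh) -(ib_right Hh) !ib_le.
Qed.

End InverseBranchTheory.

(** * The halving strategy *)

Section HalvingStrategy.
Context {R : realType}.
Implicit Types (A B E : @cinterval R) (l : seq (R * R)) (beta : R).

Definition meets B (ab : R * R) := (ab.1 <= hi B) && (lo B <= ab.2).

Lemma len_gt0 B : 0 < len B.
Proof. by rewrite subr_gt0 lo_lt_hi. Qed.

Lemma cset_sub A B : (cset A `<=` cset B) <-> lo B <= lo A /\ hi A <= hi B.
Proof.
have := lo_lt_hi A => lh; split; last first.
  by move=> [H1 H2] x; rewrite /cset /= !in_itv/=; lra.
move=> AB; split.
  have := AB (lo A); rewrite /cset /= !in_itv/= lexx ltW// => /(_ isT); lra.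
have := AB (hi A); rewrite /cset /= !in_itv/= lexx ltW// => /(_ isT); lra.
Qed.

Lemma left_quarter_subproof B : lo B < lo B + len B / 4.
Proof. by have := len_gt0 B; lra. Qed.

Lemma right_quarter_subproof B : hi B - len B / 4 < hi B.
Proof. by have := len_gt0 B; lra. Qed.

Definition left_quarter B := CInterval (left_quarter_subproof B).
Definition right_quarter B := CInterval (right_quarter_subproof B).

Definition emptier_quarter l B :=
  if (count (meets (left_quarter B)) l <= count (meets (right_quarter B)) l)%N
  then left_quarter B else right_quarter B.

Lemma emptier_quarter_bounds l B :
  [/\ lo B <= lo (emptier_quarter l B), hi (emptier_quarter l B) <= hi B &
      len (emptier_quarter l B) = len B / 4].
Proof.
have := len_gt0 B; rewrite /emptier_quarter; case: ifP => _ /=;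
  move=> B0; split; rewrite /len /= /len; move: B0; rewrite /len; lra.
Qed.

Lemma meets_sub A B ab : lo B <= lo A -> hi A <= hi B -> meets A ab -> meets B ab.
Proof.
rewrite /meets => BA AB /andP[H1 H2].
by apply/andP; split; [exact: le_trans AB|exact: le_trans H2].
Qed.

(** The two quarters are half a length of [B] apart, so that no interval of the
list meets both. *)
Lemma emptier_quarter_count l B :
    (forall ab, ab \in l -> ab.2 - ab.1 < len B / 2) ->
  (2 * count (meets (emptier_quarter l B)) l <= count (meets B) l)%N.
Proof.
move=> small.
suff : (count (meets (left_quarter B)) l + count (meets (right_quarter B)) l <=
    count (meets B) l)%N.
  rewrite /emptier_quarter; case: ifPn => H; lia.
elim: l small => //= ab l IH small.
have {}IH := IH (fun x xl => small x (mem_behead (s := ab :: l) xl)).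
have ab_small := small ab (mem_head _ _).
have L : meets (left_quarter B) ab -> meets B ab.
  by apply: meets_sub => //=; have := len_gt0 B; rewrite /len; lra.
have R' : meets (right_quarter B) ab -> meets B ab.
  by apply: meets_sub => //=; have := len_gt0 B; rewrite /len; lra.
have : meets (left_quarter B) ab -> meets (right_quarter B) ab -> False.
  by move: ab_small; rewrite /meets /= /len => ? /andP[? ?] /andP[? ?]; lra.
move: L R'; case: (meets (left_quarter B) ab); case: (meets (right_quarter B) ab);
  case: (meets B ab) => // L R' D; do ?[by case: D | by have := L isT | by have := R' isT]; lia.
Qed.

(** What Alice fixes after the first move [B0] of Bob: the number of moves in a
stage, and the list of intervals that she has to leave during a stage that is
opened by the interval [E]. The sequence in the last clause consists of the
opening intervals of the stages. *)
Definition stage_plan (beta : R) (S : set R) B0 (T : nat)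
    (threats : cinterval -> seq (R * R)) :=
  [/\ (0 < T)%N, forall E, (size (threats E) < 2 ^ T)%N,
      forall E ab, ab \in threats E ->
        ab.2 - ab.1 < (beta / 4) ^+ T * len E / 2 &
      forall E : nat -> cinterval, E 0%N = B0 ->
        (forall t, [/\ lo (E t) <= lo (E t.+1), hi (E t.+1) <= hi (E t),
           (beta / 4) ^+ T * len (E t) <= len (E t.+1) &
           len (E t.+1) <= len (E t) / 4]) ->
        forall x, (forall t, lo (E t) <= x <= hi (E t)) ->
          (forall t ab, ab \in threats (E t) -> ~ (ab.1 <= x <= ab.2)) -> S x].

(** Moves are counted from 0, so the interval that opens the current stage has
index [k %/ T * T]. *)
Definition staged_strategy (T : nat) (threats : cinterval -> seq (R * R))
    (dflt : cinterval) (hist : seq cinterval) : cinterval :=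
  let k := (size hist).-1 in
  emptier_quarter (threats (nth dflt hist (k %/ T * T))) (nth dflt hist k).

(** Within a stage the number of threats that meet the current interval is halved
by every move, so the first interval of the next stage meets none. The lengths
decrease by a factor at least [beta / 4] in each move, hence the threats remain short
compared with the current interval up to the end of the stage. *)
Lemma staged_winning beta (S : set R) B0 T threats dflt (B : nat -> cinterval) :
    0 < beta < 1 -> stage_plan beta S B0 T threats -> B 0%N = B0 ->
    (forall k, let A := staged_strategy T threats dflt (mkseq B k.+1) in
      [/\ lo A <= lo (B k.+1), hi (B k.+1) <= hi A & beta * len A <= len (B k.+1)]) ->
  (\bigcap_k cset (B k)) `&` S !=set0.
Proof.
move=> b01 [T0 szT smallT win] B0E legal.
pose l k := threats (B (k %/ T * T)%N).
have legal' k : [/\ lo (emptier_quarter (l k) (B k)) <= lo (B k.+1),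
    hi (B k.+1) <= hi (emptier_quarter (l k) (B k)) &
    beta * len (emptier_quarter (l k) (B k)) <= len (B k.+1)].
  have := legal k; rewrite /staged_strategy size_mkseq /= !nth_mkseq//.
  by rewrite ltnS leq_trunc_div.
have step k : [/\ lo (B k) <= lo (B k.+1), hi (B k.+1) <= hi (B k),
    beta / 4 * len (B k) <= len (B k.+1) & len (B k.+1) <= len (B k) / 4].
  have [H1 H2 H3] := legal' k; have [H4 H5 H6] := emptier_quarter_bounds (l k) (B k).
  split; [lra|lra|by move: H3; rewrite H6; lra|].
  by rewrite -H6 /len; lra.
have mono i k : lo (B k) <= lo (B (k + i)%N) /\ hi (B (k + i)%N) <= hi (B k).
  elim: i => [|i [IH1 IH2]]; first by rewrite addn0.
  by rewrite addnS; have [] := step (k + i)%N; lra.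
have lenlow i k : (beta / 4) ^+ i * len (B k) <= len (B (k + i)%N).
  elim: i => [|i IH]; first by rewrite addn0 expr0 mul1r.
  rewrite addnS exprS; have [_ _ H _] := step (k + i)%N.
  by apply: le_trans H; rewrite -mulrA ler_pM2l//; lra.
have lenup i k : len (B (k + i.+1)%N) <= len (B k) / 4.
  rewrite addnS; have [_ _ _ H] := step (k + i)%N; apply: le_trans H _.
  by have := mono i k; rewrite /len; lra.
pose E t := B (t * T)%N.
have cleared t i : (i <= T)%N ->
    (2 ^ i * count (meets (B (t * T + i)%N)) (threats (E t)) <= size (threats (E t)))%N.
  elim: i => [|i IH] iT; first by rewrite expn0 mul1n addn0 count_size.
  apply: leq_trans (IH (ltnW iT)); rewrite expnSr -mulnA leq_mul2l.
  apply/orP; right; rewrite addnS.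
  have lE : l (t * T + i)%N = threats (E t).
    by rewrite /l /E divnMDl// divn_small// addn0.
  have [H1 H2 _] := legal' (t * T + i)%N; rewrite lE in H1 H2.
  apply: leq_trans (_ : 2 * count (meets (emptier_quarter (threats (E t))
      (B (t * T + i)%N))) (threats (E t)) <= _)%N.
    by rewrite leq_mul2l sub_count// => ab; apply: meets_sub.
  apply: emptier_quarter_count => ab abl.
  apply: lt_le_trans (smallT _ _ abl) _.
  rewrite ler_pM2r ?invr_gt0//; apply: le_trans (lenlow i (t * T)%N).
  rewrite ler_pM2r ?len_gt0//; apply: ler_wiXn2l => //; [lra|lra|exact: ltnW].
have lohi i j : lo (B i) <= hi (B j).
  have [H1 _] := mono j i; have [_ H2] := mono i j.
  by have := lo_lt_hi (B (i + j)%N); move: H1 H2; rewrite [(j + i)%N]addnC; lra.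
pose x := sup (range (fun k => lo (B k))).
have xB k : lo (B k) <= x <= hi (B k).
  apply/andP; split.
    apply: ub_le_sup; last by exists k.
    by exists (hi (B 0%N)) => _ [i _ <-].
  apply: ge_sup; first by exists (lo (B 0%N)), 0%N.
  by move=> _ [i _ <-].
exists x; split; first by move=> k _; rewrite /cset /= in_itv; exact: xB.
apply: (win E) => //.
- move=> t; rewrite /E mulSn addnC.
  have [H1 H2] := mono T (t * T)%N; split => //.
  by rewrite -(prednK T0); apply: lenup.
- move=> t; exact: xB.
- move=> t ab abl /andP[ax xb].
  have := cleared t T (leqnn T).
  have : (0 < count (meets (B (t * T + T)%N)) (threats (E t)))%N.
    rewrite -has_count; apply/hasP; exists ab => //.
    by have := xB (t * T + T)%N; rewrite /meets => ?; apply/andP; split; lra.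
  have := szT (E t); set c := count _ _; set s := size _ => sT c0.
  by rewrite leqNgt (leq_trans sT)// leq_pmulr.
Qed.

Lemma strong_winning_of_stage_plans (S : set R) :
    (forall beta B0, 0 < beta < 1 -> cset B0 `<=` cset (@unit_cinterval R) ->
      exists T threats, stage_plan beta S B0 T threats) ->
  strong_winning (1 / 4) unit_cinterval S.
Proof.
move=> plans beta b01.
have [plan planP] : {plan : cinterval -> nat * (cinterval -> seq (R * R)) &
    forall B0, cset B0 `<=` cset (@unit_cinterval R) ->
      stage_plan beta S B0 (plan B0).1 (plan B0).2}.
  apply: (@choice _ _ (fun B0 p => cset B0 `<=` cset (@unit_cinterval R) ->
      stage_plan beta S B0 p.1 p.2)) => B0.
  have [sB0|nB0] := pselect (cset B0 `<=` cset (@unit_cinterval R)).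
    by have [T [threats P]] := plans _ _ b01 sB0; exists (T, threats).
  by exists (0%N, fun=> [::]).
pose sigma hist := let p := plan (head (@unit_cinterval R) hist) in
  staged_strategy p.1 p.2 (@unit_cinterval R) hist.
exists sigma => B; split.
  move=> n _; rewrite /alice_legal /alice /sigma /staged_strategy size_mkseq /=.
  set l := (plan _).2 _; have -> : nth (@unit_cinterval R) (mkseq B n.+1) n = B n.
    by rewrite nth_mkseq.
  have [H1 H2 H3] := emptier_quarter_bounds l (B n).
  by split; [exact/cset_sub|rewrite H3; lra].
move=> legal.
have := legal 0%N => /= /planP P.
apply: (staged_winning (dflt := @unit_cinterval R) b01 P) => // k A.
by have [/cset_sub[H1 H2] H3] := legal k.+1.
Qed.

End HalvingStrategy.

(** * The induced system of inverse branches *)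

(** A set of words that is totally ordered by the prefix order, and in which the
lengths vary by at most [N]: all its elements are prefixes of a longest one. *)
Lemma chain_enumeration (P : seq nat -> Prop) N :
    (forall w v, P w -> P v -> prefix w v || prefix v w) ->
    (forall w v, P w -> P v -> prefix w v -> (size v <= size w + N)%N) ->
  exists2 l : seq (seq nat), (size l <= N.+1)%N & forall w, P w -> w \in l.
Proof.
move=> tot bnd.
have [[w0' Pw0']|noP] := pselect (exists w, P w); last first.
  by exists [::] => // w Pw; exfalso; apply: noP; exists w.
pose S n := `[< exists2 w, P w & size w = n >].
have exS : exists n, S n by exists (size w0'); apply/asboolP; exists w0'.
case: (ex_minnP exS) => n0 /asboolP[w0 Pw0 sw0] n0min.
have pre0 w : P w -> prefix w0 w.
  move=> Pw; have := tot _ _ Pw0 Pw; rewrite !prefixE => /orP[//|/eqP tw].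
  have : S (size w) by apply/asboolP; exists w.
  move/n0min; rewrite -sw0 => sz.
  by rewrite take_oversize in tw; rewrite // tw take_size.
have Sbnd n : S n -> (n <= n0 + N)%N.
  by move=> /asboolP[w Pw <-]; rewrite -sw0; apply: bnd => //; apply: pre0.
case: (ex_maxnP exS Sbnd) => n1 /asboolP[w1 Pw1 sw1] n1max.
exists [seq take i w1 | i <- iota n0 N.+1]; first by rewrite size_map size_iota.
move=> w Pw.
have Sw : S (size w) by apply/asboolP; exists w.
have -> : w = take (size w) w1.
  have := tot _ _ Pw Pw1; rewrite !prefixE => /orP[/eqP->//|/eqP tw].
  have := n1max _ Sw; rewrite -sw1 => sz.
  by rewrite take_oversize in tw; rewrite // tw take_size.
apply: (map_f (fun i => take i w1)); rewrite mem_iota n0min//= addnS ltnS.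
exact: Sbnd.
Qed.

(** Halving [T] times beats a number of threats that grows linearly in [T]. *)
Lemma exponential_beats_affine (c a b : nat) :
  exists2 T, (0 < T)%N & (c * (a * T + b).+1 < 2 ^ T)%N.
Proof.
(* T = 2m, and 2 ^ (2m) > m * m. *)
pose m := (2 * c * a + c * b + c).+1.
exists (m + m)%N; first by rewrite /m addSn.
have m2 : (m < 2 ^ m)%N by rewrite ltn_expl.
rewrite expnD; apply: leq_ltn_trans (ltn_mul m2 m2).
have m0 : (0 < m)%N by [].
have -> : (c * (a * (m + m) + b).+1 = 2 * c * a * m + (c * b + c))%N by lia.
have : (c * b + c <= (c * b + c) * m)%N by rewrite leq_pmulr.
rewrite {3}/m; lia.
Qed.

Section InducedSystem.
Context {R : realType}.
Variables (r M M1 kap L Q : R) (phi h0 h1 : R -> R).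
Hypotheses (r01 : 0 < r < 1) (kap1 : 1 < kap) (L0 : 0 < L) (Q0 : 0 <= Q).
Hypothesis Hh0 : inverse_branch 1 M phi 0 r h0.
Hypothesis Hh1 : inverse_branch kap M1 (fun x => L * x) r 1 h1.
Hypothesis phi_ndecr : forall x y, 0 <= x -> x <= y -> phi x <= phi y.
Hypothesis phi_comparable : forall u v x y, 0 < u -> u <= x -> x <= y ->
  y <= v -> v <= M * u ->
  (phi y - phi x) * (v - u) <= Q * ((y - x) * (phi v - phi u)).

Implicit Types (a b x y A B : R) (k : nat) (w v : seq nat).

Let r_gt0 : 0 < r. Proof. by case/andP: r01. Qed.
Let r_lt1 : r < 1. Proof. by case/andP: r01. Qed.

Lemma iter_itv k x : 0 <= x <= 1 -> 0 <= iter k h0 x <= 1.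
Proof.
have rH := r01.
move=> x01; elim: k => //= k IH; have := ib_range r_gt0 Hh0 IH; lra.
Qed.

Lemma iter_lt k a b : 0 <= a -> a < b -> b <= 1 -> iter k h0 a < iter k h0 b.
Proof.
have rH := r01.
move=> a0 ab b1; elim: k => //= k IH.
have := @iter_itv k a; have := @iter_itv k b => Hb Ha.
by apply: (ib_lt r_gt0 Hh0) => //; lra.
Qed.

Lemma iter_le k a b : 0 <= a -> a <= b -> b <= 1 -> iter k h0 a <= iter k h0 b.
Proof. by move=> a0; rewrite le_eqVlt => /orP[/eqP->//|ab] b1; apply/ltW/iter_lt. Qed.

Lemma iter_contract k a b : 0 <= a -> a <= b -> b <= 1 ->
  iter k h0 b - iter k h0 a <= b - a.
Proof.
have rH := r01.
move=> a0 ab b1; elim: k => //= k IH; apply: le_trans IH.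
have := @iter_itv k a; have := @iter_itv k b => Hb Ha.
have /andP[+ _] := ib_slope Hh0 (a := iter k h0 a) (b := iter k h0 b)
  (andP (Ha ltac:(lra))).1 (iter_le k a0 ab b1) (andP (Hb ltac:(lra))).2.
by rewrite mul1r.
Qed.

Lemma iter0 k : iter k h0 0 = 0.
Proof. by elim: k => //= k ->; exact: ib_left Hh0. Qed.

Lemma iter_r k : iter k h0 r = iter k.+1 h0 1.
Proof. by rewrite iterSr (ib_right Hh0). Qed.

Lemma iter1_gt0 k : 0 < iter k h0 1.
Proof. by rewrite -(iter0 k); apply: iter_lt. Qed.

(** The points [iter k h0 1] cut (0, 1] into the fundamental intervals of the left
branch; consecutive ones are comparable. *)
Lemma iter1_comparable k : iter k h0 1 <= M * iter k.+1 h0 1.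
Proof.
have rH := r01.
have /andP[_ +] := ib_slope Hh0 (a := 0) (b := iter k h0 1) (lexx _)
  (ltW (iter1_gt0 k)) (andP (@iter_itv k 1 ltac:(lra))).2.
by rewrite (ib_left Hh0) !subr0.
Qed.

(** The one-step distortion factors 1 + x are at most exp(x), and the bounds on
the oscillations along the orbit telescope. *)
Lemma iter_distortion_of_oscillation T k A B : 0 <= T -> 0 <= A -> A <= B -> B <= 1 ->
    (forall j, phi (iter j.+1 h0 B) - phi (iter j.+1 h0 A) <=
       T * (phi (iter j.+1 h0 1) - phi (iter j.+2 h0 1))) ->
  distortion (expR (T * (phi (iter 1 h0 1) - phi (iter k.+1 h0 1)))) (iter k h0) A B.
Proof.
have rH := r01.
move=> T0 A0 AB B1 osc; elim: k => [|k IH].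
  by rewrite subrr mulr0 expR0 => a b a' b' *; rewrite mul1r mulrC.
have mon j a b : A <= a -> a <= b -> b <= B -> iter j h0 a <= iter j h0 b.
  by move=> Aa ab bB; apply: iter_le; lra.
have IA : 0 <= iter k h0 A <= 1 by apply: iter_itv; lra.
have IB : 0 <= iter k h0 B <= 1 by apply: iter_itv; lra.
have oge0 : 0 <= phi (iter k.+1 h0 B) - phi (iter k.+1 h0 A).
  rewrite subr_ge0; apply: phi_ndecr; last exact: mon.
  by have := @iter_itv k.+1 A; lra.
have /(@distortion_le _ _ (expR (T * (phi (iter 1 h0 1) - phi (iter k.+2 h0 1))))) :
    distortion (expR (T * (phi (iter 1 h0 1) - phi (iter k.+1 h0 1))) *
      (1 + (phi (iter k.+1 h0 B) - phi (iter k.+1 h0 A)))) (iter k.+1 h0) A B.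
  apply: (@distortion_comp _ _ _ (iter k h0) h0).
  - exact: expR_ge0.
  - lra.
  - by move=> a b Aa ab bB; apply: iter_lt; lra.
  - by move=> a b Aa ab bB; apply: (ib_le r_gt0 Hh0); lra.
  - exact: IH.
  - have IA0 := (andP IA).1; have IB1 := (andP IB).2.
    exact: (ib_distortion Hh0 IA0 (mon k A B (lexx A) AB (lexx B)) IB1).
apply; last by move=> a b; exact: mon.
apply: le_trans (ler_wpM2l (expR_ge0 _) (expR_ge1Dx _)) _.
rewrite -expRD ler_expR.
by have := osc k; lra.
Qed.

Let Phi := phi r - phi 0.

Let Phi_bound k : phi (iter 1 h0 1) - phi (iter k.+1 h0 1) <= Phi.
Proof.
rewrite /= (ib_right Hh0) /Phi lerB//; apply: phi_ndecr => //.
exact: ltW (iter1_gt0 k.+1).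
Qed.

Let Phi_ge0 : 0 <= Phi.
Proof. by rewrite subr_ge0 phi_ndecr// ltW. Qed.

Let theta := Q * expR Phi / (1 - r).

Let theta_ge0 : 0 <= theta.
Proof.
have rH := r01.
by rewrite divr_ge0 ?mulr_ge0 ?expR_ge0//; lra.
Qed.

Lemma iter_distortion_full k : distortion (expR Phi) (iter k h0) r 1.
Proof.
have rH := r01.
apply: (distortion_le _ _ (@iter_distortion_of_oscillation 1 k r 1 _ _ _ _ _)).
- by rewrite mul1r ler_expR.
- by move=> a b ra ab b1; apply: iter_le => //; lra.
- lra.
- lra.
- lra.
- lra.
- by move=> j; rewrite mul1r iter_r.
Qed.

(** The iterates on the whole of [r, 1] have bounded distortion, so [A, B] keeps
its proportion in the fundamental intervals up to a constant; on each of them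
the increments of [phi] are proportional to length up to a constant. *)
Lemma iter_oscillation j A B : r <= A -> A <= B -> B <= 1 ->
  phi (iter j.+1 h0 B) - phi (iter j.+1 h0 A) <=
    theta * (B - A) * (phi (iter j.+1 h0 1) - phi (iter j.+2 h0 1)).
Proof.
have rH := r01.
move=> rA AB B1.
set x := iter j.+1 h0 A; set y := iter j.+1 h0 B.
set v := iter j.+1 h0 1; set u := iter j.+2 h0 1.
have E : u = iter j.+1 h0 r by rewrite iter_r.
have D := iter_distortion_full j.+1 (lexx _) (ltW r_lt1) (lexx _) rA AB B1.
rewrite -/x -/y -/v -E in D.
have uv : u < v by rewrite E; apply: iter_lt; lra.
have C : (phi y - phi x) * (v - u) <= Q * ((y - x) * (phi v - phi u)).
  apply: phi_comparable.
  - exact: iter1_gt0.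
  - by rewrite E; apply: iter_le; lra.
  - by apply: iter_le; lra.
  - by apply: iter_le; lra.
  - exact: iter1_comparable.
have puv : 0 <= phi v - phi u.
  by rewrite subr_ge0; apply: phi_ndecr; [apply/ltW/iter1_gt0|exact: ltW].
rewrite -(ler_pM2r (x := (v - u) * (1 - r))); last by rewrite mulr_gt0//; lra.
have -> : theta * (B - A) * (phi v - phi u) * ((v - u) * (1 - r)) =
    (Q * (phi v - phi u)) * (expR Phi * ((B - A) * (v - u))).
  by rewrite /theta; field; lra.
apply: le_trans (ler_wpM2l _ D); last by rewrite mulr_ge0.
have r1 : 0 <= 1 - r by lra.
have := ler_wpM2r r1 C; lra.
Qed.

Definition induced_branch k x := iter k h0 (h1 x).

Lemma h1_itv x : 0 <= x <= 1 -> r <= h1 x <= 1.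
Proof. exact: (ib_range r_lt1 Hh1). Qed.

Lemma h1_lt a b : 0 <= a -> a < b -> b <= 1 -> h1 a < h1 b.
Proof. exact: (ib_lt r_lt1 Hh1). Qed.

Lemma h1_le a b : 0 <= a -> a <= b -> b <= 1 -> h1 a <= h1 b.
Proof. exact: (ib_le r_lt1 Hh1). Qed.

Lemma h1_contract a b : 0 <= a -> a <= b -> b <= 1 -> kap * (h1 b - h1 a) <= b - a.
Proof. by move=> a0 ab b1; have /andP[] := ib_slope Hh1 a0 ab b1. Qed.

Lemma induced_branch_itv k x : 0 <= x <= 1 -> 0 <= induced_branch k x <= 1.
Proof.
have rH := r01.
by move=> x01; apply: iter_itv; have := @h1_itv x; lra.
Qed.

Lemma induced_branch_lt k a b : 0 <= a -> a < b -> b <= 1 ->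
  induced_branch k a < induced_branch k b.
Proof.
have rH := r01.
move=> a0 ab b1; have := @h1_itv a; have := @h1_itv b => Hb Ha.
by apply: iter_lt; [lra|exact: h1_lt|lra].
Qed.

Lemma induced_branch_contract k a b : 0 <= a -> a <= b -> b <= 1 ->
  kap * (induced_branch k b - induced_branch k a) <= b - a.
Proof.
have rH := r01; have kH := kap1.
move=> a0 ab b1; apply: le_trans (h1_contract a0 ab b1).
have := @h1_itv a; have := @h1_itv b => Hb Ha.
by rewrite ler_pM2l; [apply: iter_contract; [lra|exact: h1_le|lra]|lra].
Qed.

Let rate := L + theta * Phi.

Let rate_ge0 : 0 <= rate.
Proof. by apply: addr_ge0; [exact: ltW|exact: mulr_ge0]. Qed.

(** The excess of the distortion factor is linear in the length of [A, B]; this is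
what makes the factors summable along a word. *)
Lemma induced_branch_distortion k A B : 0 <= A -> A <= B -> B <= 1 ->
  distortion (expR (rate * (B - A))) (induced_branch k) A B.
Proof.
have rH := r01; have kH := kap1; have LH := L0.
move=> A0 AB B1.
have HA : r <= h1 A <= 1 by apply: h1_itv; lra.
have HB : r <= h1 B <= 1 by apply: h1_itv; lra.
have hAB : h1 A <= h1 B by exact: h1_le.
have hc : h1 B - h1 A <= B - A.
  have := h1_contract A0 AB B1; have : h1 B - h1 A <= kap * (h1 B - h1 A).
    by rewrite ler_peMl//; lra.
  lra.
pose K2 := expR (theta * (h1 B - h1 A) *
  (phi (iter 1 h0 1) - phi (iter k.+1 h0 1))).
have : distortion ((1 + (L * h1 B - L * h1 A)) * K2) (induced_branch k) A B.
  apply: (@distortion_comp _ _ _ h1 (iter k h0)).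
  - by have : 0 <= L * h1 B - L * h1 A; [rewrite -mulrBr mulr_ge0//; lra|lra].
  - exact: expR_ge0.
  - by move=> a b Aa ab bB; apply: h1_lt; lra.
  - by move=> a b Aa ab bB; apply: iter_le; lra.
  - exact: (ib_distortion Hh1).
  - apply: iter_distortion_of_oscillation; try lra.
      by rewrite mulr_ge0//; lra.
    by move=> j; apply: iter_oscillation; lra.
apply: distortion_le; last first.
  move=> a b Aa; rewrite le_eqVlt => /orP[/eqP->//|ab] bB.
  by apply/ltW/induced_branch_lt; lra.
apply: le_trans (ler_wpM2r (expR_ge0 _) (expR_ge1Dx _)) _.
rewrite -expRD ler_expR /rate mulrDl lerD//.
  by rewrite -mulrBr ler_pM2l.
rewrite -mulrA -[leRHS]mulrA; apply: ler_wpM2l => //.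
rewrite mulrC; apply: ler_pM => //.
  rewrite subr_ge0; apply: phi_ndecr; first exact/ltW/iter1_gt0.
  rewrite -iter_r [in leRHS]/= (ib_right Hh0).
  have := @iter_contract k 0 r (lexx _) (ltW r_gt0) (ltW r_lt1).
  by rewrite iter0 !subr0.
by rewrite subr_ge0.
Qed.

Definition word_map w x := foldr induced_branch x w.
Definition word_len w := word_map w 1 - word_map w 0.

Lemma word_map_cat w v x : word_map (w ++ v) x = word_map w (word_map v x).
Proof. exact: foldr_cat. Qed.

Lemma word_map_itv w x : 0 <= x <= 1 -> 0 <= word_map w x <= 1.
Proof. by move=> x01; elim: w => //= k w IH; apply: induced_branch_itv. Qed.

Lemma word_map_lt w a b : 0 <= a -> a < b -> b <= 1 -> word_map w a < word_map w b.
Proof.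
move=> a0 ab b1; elim: w => //= k w IH; apply: induced_branch_lt => //.
- by have /andP[] : 0 <= word_map w a <= 1 by apply: word_map_itv; lra.
- by have /andP[] : 0 <= word_map w b <= 1 by apply: word_map_itv; lra.
Qed.

Lemma word_map_le w a b : 0 <= a -> a <= b -> b <= 1 -> word_map w a <= word_map w b.
Proof.
by move=> a0; rewrite le_eqVlt => /orP[/eqP->//|ab] b1; apply/ltW/word_map_lt.
Qed.

Lemma word_len_gt0 w : 0 < word_len w.
Proof. by rewrite subr_gt0 word_map_lt. Qed.

Lemma word_len_le1 w : word_len w <= 1.
Proof.
have H0 : 0 <= word_map w 0 <= 1 by apply: word_map_itv; lra.
have H1 : 0 <= word_map w 1 <= 1 by apply: word_map_itv; lra.
by rewrite /word_len; lra.
Qed.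

Lemma word_len_cons k w : kap * word_len (k :: w) <= word_len w.
Proof.
apply: induced_branch_contract; last first.
- by have /andP[] : 0 <= word_map w 1 <= 1 by apply: word_map_itv; lra.
- by apply: word_map_le.
- by have /andP[] : 0 <= word_map w 0 <= 1 by apply: word_map_itv; lra.
Qed.

Lemma word_len_exp w : kap ^+ size w * word_len w <= 1.
Proof.
have kH := kap1; elim: w => [|k w IH] /=.
  by rewrite expr0 mul1r word_len_le1.
rewrite exprSr -mulrA; apply: le_trans IH.
by rewrite ler_pM2l ?word_len_cons// exprn_gt0//; lra.
Qed.

Let total_rate := rate * kap / (kap - 1).
Definition word_distortion_const := expR total_rate.
Local Notation K := word_distortion_const.

(** The exponents contributed by the letters of a word are [rate] times the lengths
of the cylinders of its suffixes. These lengths decay geometrically when the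
suffix grows, so the exponents add up to at most [total_rate]. *)
Lemma word_map_distortion w : distortion K (word_map w) 0 1.
Proof.
have kH := kap1.
have E0 : 0 <= total_rate by rewrite divr_ge0 ?mulr_ge0//; lra.
have EE : total_rate * (kap - 1) = rate * kap by rewrite /total_rate; field; lra.
have mon u a b : 0 <= a -> a <= b -> b <= 1 -> word_map u a <= word_map u b.
  exact: word_map_le.
(* total_rate * word_len w bounds what further letters can contribute. *)
suff H : distortion (expR (total_rate * (1 - word_len w))) (word_map w) 0 1.
  apply: distortion_le H; last exact: mon.
  rewrite ler_expR ler_piMr//; have := word_len_gt0 w; lra.
elim: w => [|k w IH].
  move=> a b a' b' *; rewrite /word_len /= subr0 subrr mulr0 expR0 mul1r.
  by rewrite mulrC.
have H0 : 0 <= word_map w 0 <= 1 by apply: word_map_itv; lra.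
have H1 : 0 <= word_map w 1 <= 1 by apply: word_map_itv; lra.
have H01 : word_map w 0 <= word_map w 1 by exact: word_map_le.
have : distortion (expR (total_rate * (1 - word_len w)) * expR (rate * word_len w))
    (word_map (k :: w)) 0 1.
  apply: (@distortion_comp _ _ _ (word_map w) (induced_branch k)).
  - exact: expR_ge0.
  - exact: expR_ge0.
  - exact: word_map_lt.
  - move=> a b; rewrite [a <= b]le_eqVlt => a0 /orP[/eqP->//|ab] b1.
    by apply/ltW/induced_branch_lt; lra.
  - exact: IH.
  - by apply: induced_branch_distortion => //; lra.
apply: distortion_le; last exact: mon.
rewrite -expRD ler_expR.
have C := word_len_cons k w.
set p := word_len w in C *; set q := word_len (k :: w) in C *.
suff : rate * p <= total_rate * (p - q) by lra.
rewrite -(ler_pM2r (x := kap)); last by lra.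
have -> : rate * p * kap = total_rate * (kap - 1) * p by rewrite EE; ring.
rewrite -[leLHS]mulrA -[leRHS]mulrA; apply: ler_wpM2l => //; lra.
Qed.

Lemma word_map_modulus w a b : 0 <= a -> a <= b -> b <= 1 ->
  word_map w b - word_map w a <= K * ((b - a) * word_len w).
Proof.
move=> a0 ab b1.
have := @word_map_distortion w 0 1 a b (lexx 0) ler01 (lexx 1) a0 ab b1.
by rewrite subr0 mul1r.
Qed.

Lemma word_len_cat w v : kap ^+ size v * word_len (w ++ v) <= K * word_len w.
Proof.
have kH := kap1.
have H0 : 0 <= word_map v 0 <= 1 by apply: word_map_itv; lra.
have H1 : 0 <= word_map v 1 <= 1 by apply: word_map_itv; lra.
have H01 : word_map v 0 <= word_map v 1 by exact: word_map_le.
have := @word_map_modulus w (word_map v 0) (word_map v 1) (andP H0).1 H01 (andP H1).2.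
rewrite -!word_map_cat -/(word_len _) -/(word_len _) => H.
have k0 : 0 <= kap ^+ size v by rewrite exprn_ge0//; lra.
apply: le_trans (ler_wpM2l k0 H) _.
rewrite mulrCA; apply: ler_wpM2l; first exact: expR_ge0.
rewrite mulrA -[leRHS]mul1r ler_wpM2r ?word_len_exp//.
exact: ltW (word_len_gt0 w).
Qed.

Lemma iter1_antitone k l : (k <= l)%N -> iter l h0 1 <= iter k h0 1.
Proof.
move=> kl; rewrite -(subnKC kl) iterD; apply: iter_le => //.
  exact: ltW (iter1_gt0 _).
by have /andP[] := @iter_itv (l - k) 1 ltac:(lra).
Qed.

Lemma induced_branch_ge k x : 0 <= x <= 1 -> iter k.+1 h0 1 <= induced_branch k x.
Proof.
move=> x01; have := h1_itv x01; rewrite -iter_r => hx.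
by apply: iter_le; [exact: ltW|lra|lra].
Qed.

Lemma induced_branch_le k x : 0 <= x <= 1 -> induced_branch k x <= iter k h0 1.
Proof.
move=> x01; have := h1_itv x01; have := r_gt0 => r0 hx.
by apply: iter_le; lra.
Qed.

(** Cylinders are nested or have disjoint interiors. Different first letters give
disjoint interiors because distinct fundamental intervals only share end
points; equal first letters are removed by monotonicity. *)
Lemma word_overlap w v : word_map w 0 < word_map v 1 -> word_map v 0 < word_map w 1 ->
  prefix w v || prefix v w.
Proof.
have I u : 0 <= word_map u 0 <= 1 by apply: word_map_itv; lra.
have J u : 0 <= word_map u 1 <= 1 by apply: word_map_itv; lra.
have sep k l u u' : (k < l)%N -> word_map (k :: u) 0 < word_map (l :: u') 1 -> False.
  move=> kl; apply/negP; rewrite -leNgt.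
  apply: le_trans (induced_branch_le l (J u')) _.
  by apply: le_trans (induced_branch_ge k (I u)); apply: iter1_antitone.
have refl k a b : 0 <= a <= 1 -> 0 <= b <= 1 ->
    induced_branch k a < induced_branch k b -> a < b.
  move=> a01 b01 ab; rewrite ltNge le_eqVlt; apply/negP => /orP[/eqP eqab|ba].
    by move: ab; rewrite eqab ltxx.
  have := @induced_branch_lt k b a; move: ab; lra.
elim: w v => [|k w IH] [|l v]; rewrite ?prefix0s ?orbT//.
rewrite !prefix_cons.
case: (ltngtP k l) => [kl wv|lk _ vw|-> wv vw].
- by case: (sep _ _ _ _ kl wv).
- by case: (sep _ _ _ _ lk vw).
- by apply: IH; apply: (refl l).
Qed.

(** A cylinder that meets [u, v] and is at least as long contains [u] or [v]. The
half-open cylinders that contain a given point form a chain, and lengths decay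
geometrically along a chain. Three chains are needed, because an end point can
belong to a cylinder as its left or as its right end. *)
Lemma relevant_words_bound (rho : R) N (u v : R) : 0 < rho -> K < rho * kap ^+ N -> u < v ->
  exists2 l : seq (seq nat), (size l <= 3 * N.+1)%N &
    forall w, word_map w 0 <= v -> u <= word_map w 1 ->
      v - u <= word_len w <= (v - u) / rho -> w \in l.
Proof.
move=> rho0 KN uv; have kH := kap1.
pose win w := v - u <= word_len w <= (v - u) / rho.
have bnd w t : win w -> win t -> prefix w t -> (size t <= size w + N)%N.
  move=> /andP[_ wu] /andP[tu _] /prefixP[t' tE]; rewrite tE size_cat leq_add2l.
  rewrite leqNgt; apply/negP => Nt.
  have := word_len_cat w t'; rewrite -tE => C.
  have K0 : 0 < K by exact: expR_gt0.
  have uv0 : 0 < v - u by lra.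
  have kk : kap ^+ N <= kap ^+ size t' by rewrite ler_weXn2l//; [lra|exact: ltnW].
  have kp : 0 < kap ^+ N by rewrite exprn_gt0//; lra.
  have A1 : kap ^+ N * (v - u) <= kap ^+ size t' * word_len t by apply: ler_pM => //; lra.
  have A2 : K * word_len w <= K * ((v - u) / rho) by rewrite ler_pM2l.
  have : rho * kap ^+ N * (v - u) <= K * (v - u).
    rewrite -mulrA -[X in _ <= X](mulfVK (x := rho)); last by rewrite gt_eqF.
    rewrite [leRHS]mulrC ler_pM2l//; lra.
  by rewrite ler_pM2r//; lra.
have [l1 s1 P1] := @chain_enumeration (fun w => win w /\ word_map w 0 <= u < word_map w 1) N
  (fun w t Hw Ht => word_overlap (le_lt_trans (andP Hw.2).1 (andP Ht.2).2)
     (le_lt_trans (andP Ht.2).1 (andP Hw.2).2))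
  (fun w t Hw Ht => @bnd w t Hw.1 Ht.1).
have [l2 s2 P2] := @chain_enumeration (fun w => win w /\ word_map w 0 < u <= word_map w 1) N
  (fun w t Hw Ht => word_overlap (lt_le_trans (andP Hw.2).1 (andP Ht.2).2)
     (lt_le_trans (andP Ht.2).1 (andP Hw.2).2))
  (fun w t Hw Ht => @bnd w t Hw.1 Ht.1).
have [l3 s3 P3] := @chain_enumeration (fun w => win w /\ word_map w 0 <= v < word_map w 1) N
  (fun w t Hw Ht => word_overlap (le_lt_trans (andP Hw.2).1 (andP Ht.2).2)
     (le_lt_trans (andP Ht.2).1 (andP Hw.2).2))
  (fun w t Hw Ht => @bnd w t Hw.1 Ht.1).
exists (l1 ++ l2 ++ l3); first by rewrite !size_cat !mulSn mul0n addn0 !leq_add.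
move=> w w0v uw1 ww; rewrite !mem_cat.
have lw : word_len w = word_map w 1 - word_map w 0 by [].
have {}ww : win w by [].
have /andP[vw _] := ww.
have [w0u|w0u|w0u] := ltgtP (word_map w 0) u.
- by rewrite P2 ?orbT//; split=> //; rewrite w0u.
- by rewrite P3 ?orbT//; split=> //; rewrite w0v /=; lra.
- by rewrite P1 //; split=> //; rewrite w0u lexx /=; lra.
Qed.

Lemma expr_unbounded x : exists n, x < kap ^+ n.
Proof.
have kH := kap1.
have bern n : 1 + n%:R * (kap - 1) <= kap ^+ n.
  elim: n => [|n IH]; first by rewrite mul0r addr0 expr0.
  rewrite exprS -natr1; have : 0 <= n%:R * (kap - 1) by rewrite mulr_ge0//; lra.
  have := ler_wpM2l (ltW (lt_trans ltr01 kH)) IH => H Hn.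
  by apply: le_trans H; have := mulr_ge0 Hn (ltW (lt_trans ltr01 kH)); nra.
have [n Hn] : exists n : nat, `|x / (kap - 1)| < n%:R.
  by exists (Num.bound `|x / (kap - 1)|); apply: archi_boundP; exact: normr_ge0.
exists n; apply: lt_le_trans (bern n).
have : x / (kap - 1) < n%:R by apply: le_lt_trans Hn; exact: ler_norm.
by rewrite ltr_pdivrMr; lra.
Qed.

(** The targets in [ts] are avoided at all inverse images under the induced
system. The intervals that have to be left during a stage are the images of the
neighbourhoods of the targets under the words whose cylinder has a length
between that of the opening interval [E] and [len E / rho]. Since consecutive
opening intervals have lengths in a ratio at least [rho], and since the first
one has length at least [rho], each word is treated in some stage. *)
Lemma stage_plan_avoiding (ts : seq R) (beta : R) (B0 : cinterval) :
    (forall t, t \in ts -> 0 <= t <= 1) -> 0 < beta < 1 ->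
    cset B0 `<=` cset (@unit_cinterval R) ->
  exists T threats, forall S : set R,
    (forall x eps, 0 < eps -> 0 <= x <= 1 ->
      (forall w y t, t \in ts -> 0 <= y <= 1 -> `|y - t| <= eps ->
        x <> word_map w y) -> S x) ->
    stage_plan beta S B0 T threats.
Proof.
move=> ts01 b01 /cset_sub[/= B00 B01].
have kH := kap1.
have lB0 := len_gt0 B0.
have lB1 : len B0 <= 1 by rewrite /len; lra.
pose b4 := beta / 4.
have b40 : 0 < b4 by rewrite /b4; lra.
have b41 : b4 < 1 by rewrite /b4; lra.
have [a aP] := expr_unbounded b4^-1.
have [b bP] := expr_unbounded (K / len B0).
have [T T0 TP] := exponential_beats_affine (size ts * 3) a b.
pose N := (a * T + b)%N.
have bT0 : 0 < b4 ^+ T by rewrite exprn_gt0.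
have bT1 : b4 ^+ T <= 1 by rewrite exprn_ile1//; lra.
(* The factor len B0 accounts for the first stage, in which all cylinders
   longer than B0 have to be treated. *)
pose rho := b4 ^+ T * len B0.
have rho0 : 0 < rho by rewrite mulr_gt0.
have rhobT : rho <= b4 ^+ T by rewrite /rho ler_piMr//; lra.
have K0 : 0 < K by exact: expR_gt0.
have KN : K < rho * kap ^+ N.
  have -> : rho * kap ^+ N = (b4 * kap ^+ a) ^+ T * (len B0 * kap ^+ b).
    by rewrite /rho /N exprD exprM (exprMn _ b4) mulrACA.
  have H1 : 1 <= (b4 * kap ^+ a) ^+ T.
    by rewrite exprn_ege1// ltW// mulrC -ltr_pdivrMr// div1r.
  have H2 : K < len B0 * kap ^+ b by rewrite mulrC -ltr_pdivrMr.
  by apply: lt_le_trans H2 _; rewrite ler_peMl// mulr_ge0 ?exprn_ge0//; lra.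
(* The images then have length at most b4 ^+ T * len E / 4, less than half
   the length of every interval of the stage. *)
pose eps := b4 ^+ T * rho / (8 * K).
have eps0 : 0 < eps by rewrite divr_gt0 ?mulr_gt0.
pose J w (t : R) := (word_map w (Num.max (t - eps) 0), word_map w (Num.min (t + eps) 1)).
have Jend t : t \in ts -> [/\ 0 <= Num.max (t - eps) 0,
    Num.max (t - eps) 0 <= Num.min (t + eps) 1, Num.min (t + eps) 1 <= 1 &
    Num.min (t + eps) 1 - Num.max (t - eps) 0 <= 2 * eps].
  move=> /ts01 t01; have := eps0.
  by rewrite /Num.max /Num.min; case: ifP => ?; case: ifP => ?; split; lra.
have [l lP] : {l : cinterval -> seq (seq nat) & forall E : cinterval,
    (size (l E) <= 3 * N.+1)%N /\ forall w, word_map w 0 <= hi E ->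
      lo E <= word_map w 1 -> len E <= word_len w <= len E / rho -> w \in l E}.
  apply: (@choice _ _ (fun (E : cinterval) (l : seq (seq nat)) =>
    (size l <= 3 * N.+1)%N /\ forall w, word_map w 0 <= hi E ->
      lo E <= word_map w 1 -> len E <= word_len w <= len E / rho -> w \in l)) => E.
  by have [l] := relevant_words_bound rho0 KN (lo_lt_hi E); exists l.
pose l' (E : cinterval) := [seq w <- l E | word_len w <= len E / rho].
pose threats (E : cinterval) := [seq J w t | w <- l' E, t <- ts].
exists T, threats => S SP; split => //.
- move=> E; rewrite size_allpairs; apply: leq_ltn_trans TP.
  rewrite -mulnA mulnC leq_mul2l; apply/orP; right.
  by apply: leq_trans (lP E).1; rewrite size_filter count_size.
- move=> E ab /allpairsP[[w t] /= [wl tts ->]] /=.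
  move: wl; rewrite mem_filter => /andP[wE _].
  have [J0 J01 J1 Jlen] := Jend t tts.
  apply: le_lt_trans (word_map_modulus w J0 J01 J1) _.
  have lE := len_gt0 E.
  have H1 : K * ((Num.min (t + eps) 1 - Num.max (t - eps) 0) * word_len w) <=
      K * (2 * eps * (len E / rho)).
    rewrite ler_pM2l//; apply: ler_pM => //; first by rewrite subr_ge0.
    exact: ltW (word_len_gt0 w).
  apply: le_lt_trans H1 _.
  have -> : K * (2 * eps * (len E / rho)) = b4 ^+ T * len E / 4.
    by rewrite /eps; field; rewrite !gt_eqF.
  by have := mulr_gt0 bT0 lE; rewrite -/b4; lra.
- move=> E E0 Estep x xE xth.
  have elen t : len (E t) <= len B0 / 4 ^+ t.
    elim: t => [|t IH]; first by rewrite expr0 divr1 E0.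
    have [_ _ _ H] := Estep t; rewrite exprS invfM.
    by apply: le_trans H _; have := IH; lra.
  apply: (SP x eps) => //; first by have := xE 0%N; rewrite E0; lra.
  move=> w y t tts y01 yt xy.
  have sw := word_len_gt0 w; have sw1 := word_len_le1 w.
  have ex : exists n, len (E n) <= word_len w.
    have [n Hn] : exists n : nat, (word_len w)^-1 < n%:R.
      exists (Num.bound (word_len w)^-1); apply: archi_boundP.
      by rewrite invr_ge0 ltW.
    exists n; apply: le_trans (elen n) _.
    rewrite ler_pdivrMr ?exprn_gt0//.
    have n4 : n%:R <= 4 ^+ n :> R by rewrite -natrX ler_nat ltnW// ltn_expl.
    have : 1 < word_len w * 4 ^+ n.
      rewrite mulrC -ltr_pdivrMr// div1r; exact: lt_le_trans n4.
    lra.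
  case: (ex_minnP ex) => n nlen nmin.
  have up : word_len w <= len (E n) / rho.
    rewrite ler_pdivlMr//; case: n nlen nmin => [|n] nlen nmin.
      rewrite E0 /rho mulrA ler_piMl//; first exact: ltW.
      by rewrite mulr_ile1// ltW.
    have nn : word_len w < len (E n).
      by rewrite ltNge; apply/negP => /nmin; rewrite ltnn.
    have [_ _ H _] := Estep n; apply: le_trans H.
    rewrite mulrC; apply: ler_pM => //; exact: ltW.
  have [J0 J01 J1 _] := Jend t tts.
  have /andP[y0 y1] := y01.
  have Jy : Num.max (t - eps) 0 <= y <= Num.min (t + eps) 1.
    by move: yt; rewrite ler_norml ge_max le_min y0 y1 !andbT; lra.
  have [xlo xhi] : (J w t).1 <= x /\ x <= (J w t).2.
    rewrite xy /=; split; apply: word_map_le => //; [by case/andP: Jy|by case/andP: Jy].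
  apply: (xth n (J w t)); last by rewrite xlo.
  have /andP[xl xh] := xE n.
  apply: allpairs_f => //; rewrite mem_filter up; apply: (lP (E n)).2.
  + by apply: le_trans xh; rewrite xy; apply: word_map_le.
  + by apply: (le_trans xl); rewrite xy; apply: word_map_le.
  + by rewrite nlen.
Qed.

End InducedSystem.

(** * Orbits and the final argument *)

Section Dynamics.
Context {R : realType} (f : R -> R) (r : R).
Hypothesis hf : manneville_pomeau_at f r.
Implicit Types (p q x y : R).

Lemma mp_iter_itv n x : 0 <= x <= 1 -> 0 <= iter n f x <= 1.
Proof. by move=> x01; elim: n => //= n; exact: (mp_self_map hf). Qed.

(** The alternative of 0 is there for [r] and its preimages: the jump of [f] sends
the two sides of such a point to different places. *)
Definition returns_near p q := forall e, 0 < e ->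
  exists2 eta, 0 < eta & forall y, 0 <= y <= 1 -> `|y - p| < eta ->
    exists2 m, r <= iter m f y &
      `|iter m.+1 f y| < e \/ `|iter m.+1 f y - q| < e.

(** Here a single application of the map, continuous at [p], is enough. *)
Lemma returns_near_right p : r < p <= 1 -> returns_near p (f p).
Proof.
move=> rp e e0; have r01 := mp_r01 hf.
have [|d d0 dP] := @bderivable_continuous _ r f p _ e e0.
  by apply: (mp_bderivable hf); lra.
exists (Num.min d (p - r)); first by rewrite lt_min d0; lra.
move=> y y01; rewrite lt_min => /andP[yd]; rewrite ltr_norml => yr.
exists 0%N => /=; first lra.
by right; rewrite distrC; apply: dP => //; apply: branch_sub_right; lra.
Qed.

(** Points to the right of [r] are mapped close to 0. Points to the left are mapped
close to 1, which lies in the second branch and is fixed. *)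
Lemma returns_near_discontinuity : returns_near r 1.
Proof.
move=> e e0; have r01 := mp_r01 hf.
have [|d d0 dP] := @bderivable_continuous _ r f r _ e e0.
  by apply: (mp_bderivable hf); lra.
have [|u u0 uP] := @bderivable_continuous _ r f 1 _ e e0.
  by apply: (mp_bderivable hf); lra.
have [|v v0 vP] := mp_left_near1 hf (e := Num.min u (1 - r)).
  by rewrite lt_min u0; lra.
exists (Num.min d v); first by rewrite lt_min d0.
move=> y y01; rewrite lt_min => /andP[yd]; rewrite ltr_norml => yv.
have [yr|ry] := ltP y r.
  have fy : f y < 1 by have := @mp_left_lt1 _ _ _ hf y; lra.
  have [] : 1 - f y < u /\ r < f y.
    have : 1 - f y < Num.min u (1 - r) by apply: vP; lra.
    by rewrite lt_min; lra.
  move=> fyu rfy; exists 1%N => /=; first exact: ltW.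
  right; rewrite distrC -[1 in X in X < _](mp_f1 hf); apply: uP.
    by apply: branch_sub_right; lra.
  by rewrite ltr_norml; lra.
exists 0%N => //=; left.
have := dP y; rewrite (mp_fr hf) sub0r normrN; apply=> //.
by apply: branch_sub_right; lra.
Qed.

Lemma returns_near_left p q : 0 < p < r -> returns_near (f p) q -> returns_near p q.
Proof.
move=> pr near_fp e e0; have r01 := mp_r01 hf.
have [eta eta0 etaP] := near_fp e e0.
have [|d d0 dP] := @bderivable_continuous _ r f p _ eta eta0.
  by apply: (mp_bderivable hf); lra.
exists (Num.min d (r - p)); first by rewrite lt_min d0; lra.
move=> y y01; rewrite lt_min => /andP[yd]; rewrite ltr_norml => yr.
have [||m rm Hm] := etaP (f y).
- exact: (mp_self_map hf).
- by rewrite distrC; apply: dP => //; apply: branch_sub_left; lra.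
by exists m.+1; rewrite iterSr // [iter m.+2 _ _]iterSr.
Qed.

(** A point of (0, r) is pushed to the right by at least a fixed amount in each
step, so it reaches [r, 1] after finitely many steps. *)
Lemma returns_near_exists p : 0 < p <= 1 -> exists2 q, 0 <= q <= 1 & returns_near p q.
Proof.
move=> p01; have r01 := mp_r01 hf.
have base x : r <= x <= 1 -> exists2 q, 0 <= q <= 1 & returns_near x q.
  move=> /andP[]; rewrite le_eqVlt => /orP[/eqP<- _|rx x1].
    by exists 1; [lra|exact: returns_near_discontinuity].
  exists (f x); first by apply: (mp_self_map hf); lra.
  by apply: returns_near_right; rewrite rx.
have [pr|rp] := ltP p r; last by apply: base; lra.
have d0 : 0 < f p - p.
  have := @mp_left_expanding _ _ _ hf 0 p (lexx _) (andP p01).1 pr.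
  by rewrite (mp_f0 hf); lra.
have grow x : p <= x < r -> x + (f p - p) <= f x.
  move=> /andP[]; rewrite le_eqVlt => /orP[/eqP<- _|px xr]; first lra.
  by have := @mp_left_expanding _ _ _ hf p x (ltW (andP p01).1) px xr; lra.
have step n x : p <= x <= 1 -> r <= x + n%:R * (f p - p) ->
    exists2 q, 0 <= q <= 1 & returns_near x q.
  elim: n x => [|n IH] x px; first by rewrite mul0r addr0 => rx; apply: base; lra.
  have [xr|rx] := ltP x r; last by move=> _; apply: base; lra.
  rewrite -natr1 mulrDl mul1r => H.
  have Hx := grow x; have fx : 0 <= f x <= 1 by apply: (mp_self_map hf); lra.
  have [||q q01 qP] := IH (f x); [lra|lra|].
  by exists q => //; apply: returns_near_left => //; lra.
apply: (step (Num.bound (r / (f p - p)))); first lra.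
have := archi_boundP (x := r / (f p - p)).
rewrite divr_ge0; [|lra|lra] => /(_ isT).
by rewrite ltr_pdivrMr//; lra.
Qed.

Variables h0 h1 : R -> R.
Hypothesis h0f : forall x, 0 <= x < r -> h0 (f x) = x.
Hypothesis h1f : forall x, r <= x <= 1 -> h1 (f x) = x.

(** Letters count the passages through the left branch before a visit to the right
branch. *)
Lemma itinerary n x : 0 <= x <= 1 -> r <= iter n f x ->
  exists k w, x = word_map h0 h1 (k :: w) (iter n.+1 f x).
Proof.
elim: n x => [|n IH] x x01 rn.
  by exists 0%N, [::]; rewrite /word_map /= /induced_branch /= h1f //; move: rn => /=; lra.
rewrite iterSr in rn; have fx01 := mp_self_map hf x01.
have [k [w E]] := IH (f x) fx01 rn.
rewrite iterSr; have [xr|rx] := ltP x r.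
  exists k.+1, w; have hx : h0 (f x) = x by apply: h0f; lra.
  by rewrite -[LHS]hx; exact: (congr1 h0 E).
exists 0%N, (k :: w); have hx : h1 (f x) = x by apply: h1f; lra.
by rewrite -[LHS]hx; exact: (congr1 h1 E).
Qed.

(** For [p = 0] no return is needed: the orbit moves away from 0 inside the left
branch, and it enters a neighbourhood of 0 only directly after a visit to the
right branch, or at time 0, where the empty word applies. *)
Lemma avoids_exceptional p q eps x : 0 <= p <= 1 -> (0 < p -> returns_near p q) ->
    0 < eps -> 0 <= x <= 1 ->
    (forall w y t, t \in [:: 0; q] -> 0 <= y <= 1 -> `|y - t| <= eps ->
      x <> word_map h0 h1 w y) ->
  exceptional_set f p x.
Proof.
move=> p01 pq eps0 x01 avoid; split => // clp.
have away n t : t \in [:: 0; q] -> r <= iter n f x -> eps < `|iter n.+1 f x - t|.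
  move=> tq rn; have [k [w E]] := itinerary x01 rn.
  by rewrite ltNge; apply/negP => H; apply: (avoid _ _ _ tq _ H E); exact: mp_iter_itv.
have in0 : 0 \in [:: 0; q] by rewrite inE eqxx.
have inq : q \in [:: 0; q] by rewrite !inE eqxx orbT.
have visit eta : 0 < eta -> exists n, `|iter n f x - p| < eta.
  move=> eta0; have [_ [[n _ <-] Hn]] := clp _ (nbhsx_ballx p eta eta0).
  by exists n; rewrite distrC.
move: (p01) => /andP[]; rewrite le_eqVlt => /orP[/eqP p0 _|p0 _].
  have low n : eps < iter n f x.
    have range m := mp_iter_itv m x01.
    elim: n => [|n IH].
      rewrite ltNge; apply/negP => xe; apply: (avoid [::] x 0 in0 x01) => //.
      by rewrite subr0 ger0_norm//; lra.
    have [nr|rn] := ltP (iter n f x) r; last first.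
      have := away n 0 in0 rn; rewrite subr0 ger0_norm//.
      by have := range n.+1; lra.
    apply: (lt_trans IH) => /=.
    have := @mp_left_expanding _ _ _ hf 0 (iter n f x) (lexx _) (lt_trans eps0 IH) nr.
    by rewrite (mp_f0 hf) !subr0.
  have [n] := visit eps eps0; rewrite -p0 subr0 ger0_norm; last by have := low n; lra.
  by have := low n; lra.
have [eta eta0 etaP] := pq p0 eps eps0.
have [n np] := visit eta eta0.
have [m rm Hm] := etaP (iter n f x) (mp_iter_itv n x01) np.
rewrite -!iterD in rm Hm.
have := away (m + n)%N 0 in0 rm; have := away (m + n)%N q inq rm.
by rewrite subr0 -addSn; case: Hm; lra.
Qed.

End Dynamics.

Theorem theorem1p1 (R : realType) (f : R -> R) (hf : manneville_pomeau f) :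
  exists alpha : R, 0 < alpha < 1 / 2 /\
    forall p : R, 0 <= p <= 1 ->
      strong_winning alpha unit_cinterval (exceptional_set f p).
Proof.
have [r hr] := hf; have r01 := mp_r01 hr.
exists (1 / 4); split; first lra.
move=> p p01.
have [M [c [gamma [M1 c0 g0 sl0]]]] := mp_left_slopes hr.
have [M' [kap [L [L0 kap1 sl1]]]] := mp_right_slopes hr.
have phi_ndecr (x y : R) : 0 <= x -> x <= y -> c * x `^ gamma <= c * y `^ gamma.
  move=> x0 xy; rewrite ler_pM2l//; apply: ge0_ler_powR => //; rewrite ?nnegrE//; lra.
have [Q Q0 phiQ] := power_profile_comparable M1 c0 g0.
have [||||||h0 Hh0 h0f] := inverse_branch_exists _ _ sl0.
- lra.
- lra.
- by move=> x y x0 xy _; apply: phi_ndecr.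
- by rewrite /left_branch ifT ?(mp_f0 hr)//; lra.
- by rewrite /left_branch ltxx.
- move=> y /andP[y0]; rewrite le_eqVlt => /orP[/eqP->|y1].
    by exists r; rewrite /left_branch ?ltxx//; lra.
  have [|x xr fx] := @mp_left_surj _ _ _ hr y; first lra.
  by exists x; [lra|rewrite /left_branch ifT//; lra].
have [||||||h1 Hh1 h1f] := inverse_branch_exists _ _ sl1.
- lra.
- lra.
- by move=> x y _ xy _; rewrite ler_pM2l.
- exact: (mp_fr hr).
- exact: (mp_f1 hr).
- by move=> y y01; apply: (mp_right_surj hr).
have [q q01 pq] : exists2 q, 0 <= q <= 1 & 0 < p -> returns_near f r p q.
  have [p0|p0] := leP p 0; first by exists 0; [lra|lra].
  have [|q q01 pq] := @returns_near_exists _ _ _ hr p; first lra.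
  by exists q.
apply: strong_winning_of_stage_plans => beta B0 b01 B01.
have ts01 t : t \in [:: 0; q] -> 0 <= t <= 1.
  by rewrite !inE => /orP[/eqP->|/eqP->]; lra.
have [T [threats plan]] :=
  stage_plan_avoiding r01 kap1 L0 Q0 Hh0 Hh1 phi_ndecr phiQ ts01 b01 B01.
exists T, threats; apply: plan => x eps eps0 x01 avoid.
apply: (avoids_exceptional hr (h0 := h0) (h1 := h1) _ _ p01 pq eps0 x01 avoid).
- move=> y yr; have [|_] := h0f y; first lra.
  by rewrite /left_branch ifT//; lra.
- by move=> y yr; have [] := h1f y yr.
Qed.
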